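(* Let $t = 4\ell + r$, where $\ell \ge 0$ and $0\le r\le 3$ are integers. Then $$\widetilde{U}_t(n) \leq \left(\frac{7\ell}{2} + r\right)n + O_\ell(\log n)$$ as $n\to\infty$, where the implied constant depends only on $\ell$. Moreover, $$\widetilde{U}(n) \leq \frac{7}{8}\binom{n}{2} + O(n\log n)$$ as $n \to \infty$.
   Context: For distinct positions $a,b \in \{1,\dots,n\}$ and $p\in[0,1]$, the lazy transposition $(a,b,p)$ is the random permutation that equals the transposition $(a,b)$ with probability $p$ and the identity with probability $1-p$. Consider $t\le n$ distinguishable counters placed initially in positions $1,\dots,t$ of the $n$ positions $1,\dots,n$, the other positions being empty. A transposition $(a,b)$ switches the contents of positions $a$ and $b$ (which may include switching a counter with an empty space, or two empty spaces). A sequence of independent lazy transpositions, applied in order, gives a random final placement of the $t$ counters; the sequence is called a $(t,n)$-shuffle if this final placement is uniformly distributed over all $t!\binom{n}{t}$ placements of the $t$ distinguishable counters in distinct positions. A star transposition is a (lazy) transposition of the form $(1,b,p)$, i.e. one involving position $1$. $\widetilde{U}_t(n)$ denotes the minimum length of a $(t,n)$-shuffle in which every transposition is a star transposition, and $\widetilde{U}(n) = \widetilde{U}_n(n)$. *)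

(* Defs.v *)
From HB Require Import structures.
From mathcomp Require Import all_boot all_order all_algebra all_fingroup.
From mathcomp Require Import all_classical all_reals all_analysis.

Set Implicit Arguments.
Unset Strict Implicit.
Unset Printing Implicit Defensive.

Import Order.TTheory GRing.Theory Num.Theory.
Local Open Scope ring_scope.

(* The positions 1, ..., n are represented by the ordinals 0, ..., n-1 of 'I_n. *)

Record lazy_transposition (R : realType) (n : nat) := LazyTransposition {
  lazy_fst : 'I_n;
  lazy_snd : 'I_n;
  lazy_prob : R;
  lazy_neq : lazy_fst != lazy_snd;
  lazy_prob01 : 0 <= lazy_prob <= 1
}.

(* Probability mass function of the random permutation (a,b,p). *)
Definition lazy_law (R : realType) (n : nat) (T : lazy_transposition R n)
    (s : 'S_n) : R :=
  lazy_prob T * (s == tperm (lazy_fst T) (lazy_snd T))%:R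
  + (1 - lazy_prob T) * (s == 1%g)%:R.

Definition is_star (R : realType) (n : nat) (T : lazy_transposition R n) : bool :=
  (lazy_fst T == 0%N :> nat) || (lazy_snd T == 0%N :> nat).

(* A placement sends each counter to its position.  Counter i starts in        *)
(* position i; a permutation s moves the contents of position x to s x, and    *)
(* since (s * s') x = s' (s x) in 'S_n, the product in increasing order of the *)
(* index applies the permutations in the order of the sequence.                *)
Definition final_placement (t n : nat) (le_tn : (t <= n)%N) (m : nat)
    (s : {ffun 'I_m -> 'S_n}) : {ffun 'I_t -> 'I_n} :=
  [ffun i => (\prod_(j < m) s j)%g (widen_ord le_tn i)].

(* By independence, the joint law of the permutations is the product law on   *)
(* {ffun 'I_m -> 'S_n}.                                                       *)
Definition placement_prob (R : realType) (t n : nat) (le_tn : (t <= n)%N)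
    (m : nat) (Ts : m.-tuple (lazy_transposition R n))
    (f : {ffun 'I_t -> 'I_n}) : R :=
  \sum_(s : {ffun 'I_m -> 'S_n} | final_placement le_tn s == f)
    \prod_(j < m) lazy_law (tnth Ts j) (s j).

Definition is_shuffle (R : realType) (t n : nat) (le_tn : (t <= n)%N)
    (m : nat) (Ts : m.-tuple (lazy_transposition R n)) : Prop :=
  forall f : {ffun 'I_t -> 'I_n}, injective f ->
    placement_prob le_tn Ts f = (t`! * 'C(n, t))%:R^-1.

Definition has_star_shuffle (R : realType) (t n m : nat) : Prop :=
  exists (le_tn : (t <= n)%N) (Ts : m.-tuple (lazy_transposition R n)),
    all (@is_star R n) Ts /\ is_shuffle le_tn Ts.

(* m is the minimum length of a (t,n)-shuffle by star transpositions.  This is *)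
(* a relation rather than a function of t and n, so that it has no default     *)
(* value: asserting it for some m includes that star shuffles exist.           *)
Definition is_min_star_length (R : realType) (t n m : nat) : Prop :=
  has_star_shuffle R t n m /\
  forall k : nat, has_star_shuffle R t n k -> (m <= k)%N.

(* Main.v *)
Require Import Defs.
From HB Require Import structures.
From mathcomp Require Import all_boot all_order all_algebra all_fingroup.
From mathcomp Require Import all_classical all_reals all_analysis.
From mathcomp Require Import fintype finset ring lra zify.

Set Implicit Arguments.
Unset Strict Implicit.
Unset Printing Implicit Defensive.

Import Order.TTheory GRing.Theory Num.Theory.
Local Open Scope ring_scope.

(** Encode the law of a random permutation, with weights a, as the element
    \sum_s a s *: gelt s of the group algebra of 'S_n; applying independent
    permutations one after the other is multiplication.  Let e(A) stand for
    savg A, the uniform law on the permutations that move only points of A.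
    A word Z of lazy transpositions spreads counters from the positions X
    uniformly over N as soon as e(N \ X) * Z = e(N) ([shuffles]): the factor
    e(N \ X) erases all information on a permutation of N except the images of
    X.  Such identities chain: spread X \ Y over N \ Y and then Y over N
    ([shuffle_costD]).  So it is enough to spread a few counters at a time, and
    one sweep of |N| - 1 star transpositions spreads a single one when the
    centre is in N ([insertion]).

    The gain comes from spreading four counters with 7 |N| / 2 + O(log |N|)
    star transpositions instead of 4 |N|.  Arrange 3m positions in m rows of
    three (triples), hence in three columns of m (blocks).  If the counters are
    uniform inside each block, given how many there are in each block, and each
    triple is then permuted uniformly, the resulting law does not change when
    the three occupancy numbers are permuted, because exchanging two blocks
    only permutes inside the triples ([outcome_of01], [outcome_of12]).  One may
    therefore sort the occupancies: block 0 must cope with four counters,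
    block 1 with two and block 2 with one.  With C(m) the cost of spreading four
    counters over m positions, this costs C(m) + 2m + m for the blocks and 4m
    for the triples ([star_word_triples]), so C(3m) <= C(m) + 7m + O(1) and
    C(n) <= 7n/2 + O(log n) ([shuffle_cost4]).

    Two points need care.  The sorted occupancy must be 4, 31, 22 or 211 with
    the probabilities of a uniform set of four positions, and this must be
    arranged by boundedly many lazy transpositions between 4 + 2 + 1 slots.
    Starting from four counters in block 0, four lazy transpositions suffice,
    with probabilities obtained from the roots of a quadratic polynomial
    ([mixing_probabilities], [grid_mixture]).  And the number of positions is
    seldom of the form 3m: positions are added one by one, each at a bounded
    cost, by letting the counters compete for the new position beforehand
    ([extend_by]).

    For 4l + r counters one spreads l groups of four and r single counters.
    When all n positions carry a counter, the groups of four live on 4j + r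
    positions for j = 1, ..., l, and the sum of their costs is
    7/8 'C(n, 2) + O(n log n) ([shuffle_cost_all]). *)

(** * Uniform laws in the group algebra *)

(** The law with weights a is \sum_g a g *: gelt g, and the product of two laws
    is the law of a product of independent elements.  The functions gcoef make
    the weights recoverable from the element. *)
Record group_algebra (R : realFieldType) (gT : finGroupType) := GroupAlgebra {
  ga_sort :> algType R;
  gelt : gT -> ga_sort;
  gelt1 : gelt 1%g = 1;
  geltM : forall g h, gelt (g * h)%g = gelt g * gelt h;
  gcoef : ga_sort -> gT -> R;
  gcoefE : forall (a : gT -> R) h, gcoef (\sum_g a g *: gelt g) h = a h
}.

Section RegularRepresentation.
Variables (R : realFieldType) (gT : finGroupType).

Lemma card_prednK : #|gT|.-1.+1 = #|gT|.
Proof. by apply/prednK/card_gt0P; exists 1%g. Qed.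

Let elt (i : 'I_#|gT|.-1.+1) : gT := enum_val (cast_ord card_prednK i).
Let idx (g : gT) : 'I_#|gT|.-1.+1 := cast_ord (esym card_prednK) (enum_rank g).

Let idxK : cancel idx elt.
Proof. by move=> g; rewrite /elt /idx cast_ordKV enum_rankK. Qed.

Let eltK : cancel elt idx.
Proof. by move=> i; rewrite /elt /idx enum_valK cast_ordK. Qed.

(** The right regular representation: the row of the unit lists the weights. *)
Definition regular_mx (g : gT) : 'M[R]_#|gT|.-1.+1 :=
  \matrix_(i, j) (elt j == elt i * g)%g%:R.

Lemma regular_mx1 : regular_mx 1%g = 1.
Proof.
by apply/matrixP=> i j; rewrite !mxE mulg1 (inj_eq (can_inj eltK)) eq_sym.
Qed.

Lemma regular_mxM g h : regular_mx (g * h)%g = regular_mx g * regular_mx h.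
Proof.
apply/matrixP=> i j; rewrite !mxE (bigD1 (idx (elt i * g)%g)) //=.
rewrite big1 ?addr0 => [|k]; rewrite !mxE ?idxK ?eqxx ?mul1r ?mulgA //.
by rewrite -(inj_eq (can_inj eltK)) idxK => /negPf ->; rewrite mul0r.
Qed.

Lemma regular_mx_coef (a : gT -> R) h :
  (\sum_g a g *: regular_mx g) (idx 1%g) (idx h) = a h.
Proof.
rewrite summxE (bigD1 h) //= !mxE !idxK mul1g eqxx mulr1 big1 ?addr0 //.
by move=> g gh; rewrite !mxE !idxK mul1g eq_sym (negPf gh) mulr0.
Qed.

Definition regular_algebra : group_algebra R gT :=
  @GroupAlgebra R gT 'M[R]_#|gT|.-1.+1 regular_mx regular_mx1 regular_mxM
    (fun Z h => Z (idx 1%g) (idx h)) regular_mx_coef.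

End RegularRepresentation.

Section GroupAverages.
Variables (R : realFieldType) (gT : finGroupType) (A : group_algebra R gT).
Implicit Types (g h : gT) (K H : {group gT}) (Z : A).

Local Notation rho := (gelt A).

Lemma geltVK g : rho g^-1 * rho g = 1.
Proof. by rewrite -geltM mulVg gelt1. Qed.

Lemma geltKV g : rho g * rho g^-1 = 1.
Proof. by rewrite -geltM mulgV gelt1. Qed.

(** The uniform law on K.  It is locked because rewriting with algebra laws
    would otherwise look through it and expand the sum. *)
Definition gavg (K : {set gT}) : A :=
  locked (#|K|%:R^-1 *: \sum_(k in K) rho k).

Lemma gavgE (K : {set gT}) : gavg K = #|K|%:R^-1 *: \sum_(k in K) rho k.
Proof. by rewrite /gavg -lock. Qed.

Lemma cardG_neq0 K : #|K|%:R != 0 :> R.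
Proof. by rewrite pnatr_eq0 -lt0n cardG_gt0. Qed.

Lemma gavgMl K k : k \in K -> rho k * gavg K = gavg K.
Proof.
move=> kK; rewrite gavgE -scalerAr mulr_sumr; congr (_ *: _).
under eq_bigr do rewrite -geltM.
rewrite [RHS](reindex_inj (mulgI k)) /=.
by apply: eq_bigl => x; rewrite groupMl.
Qed.

Lemma gavgMr K k : k \in K -> gavg K * rho k = gavg K.
Proof.
move=> kK; rewrite gavgE -scalerAl mulr_suml; congr (_ *: _).
under eq_bigr do rewrite -geltM.
rewrite [RHS](reindex_inj (mulIg k)) /=.
by apply: eq_bigl => x; rewrite groupMr.
Qed.

Lemma gavg_fixl K Z : (forall k, k \in K -> rho k * Z = Z) -> gavg K * Z = Z.
Proof.
move=> fix_Z; rewrite gavgE -scalerAl mulr_suml (eq_bigr (fun=> Z)) //.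
by rewrite sumr_const -scaler_nat scalerA mulVf ?cardG_neq0 ?scale1r.
Qed.

Lemma gavg_fixr K Z : (forall k, k \in K -> Z * rho k = Z) -> Z * gavg K = Z.
Proof.
move=> fix_Z; rewrite gavgE -scalerAr mulr_sumr (eq_bigr (fun=> Z)) //.
by rewrite sumr_const -scaler_nat scalerA mulVf ?cardG_neq0 ?scale1r.
Qed.

Lemma gavg_absl K H : K \subset H -> gavg K * gavg H = gavg H.
Proof. by move=> sKH; apply: gavg_fixl => k /(subsetP sKH); apply: gavgMl. Qed.

Lemma gavg_absr K H : K \subset H -> gavg H * gavg K = gavg H.
Proof. by move=> sKH; apply: gavg_fixr => k /(subsetP sKH); apply: gavgMr. Qed.

Lemma gavgJ K g : gavg K * rho g = rho g * gavg (K :^ g)%g.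
Proof.
rewrite !gavgE cardJg -scalerAl -scalerAr mulr_suml mulr_sumr.
congr (_ *: _).
rewrite [RHS](reindex_inj (conjg_inj g)) /=.
by apply: eq_big => [k|k _]; rewrite ?memJ_conjg // -!geltM -conjgC.
Qed.

Lemma gavg_comm K Z :
  (forall k, k \in K -> Z * rho k = rho k * Z) -> Z * gavg K = gavg K * Z.
Proof.
move=> cZ; rewrite gavgE -scalerAr -scalerAl mulr_sumr mulr_suml.
by congr (_ *: _); apply: eq_bigr.
Qed.

End GroupAverages.

Section SymmetricAverages.
Variables (R : realFieldType) (n : nat) (G : group_algebra R {perm 'I_n}).
Implicit Types (A B N X : {set 'I_n}) (s t : 'S_n) (Z : G).

Local Notation rho := (gelt G).
Definition savg A := gavg G (Sym A).

Lemma SymP A s : reflect (forall x, x \notin A -> s x = x) (s \in Sym A).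
Proof.
rewrite inE; apply: (iffP subsetP) => [sA x | sA x]; last first.
  by rewrite inE; apply: contraR => /sA ->.
by move=> xA; apply/eqP; apply: contraR xA => sx; apply: sA; rewrite inE.
Qed.

Lemma Sym_stable A s : s \in Sym A -> s @: A = A.
Proof. by rewrite inE; apply: im_perm_on. Qed.

Lemma imset_permD A B s : s @: (A :\: B) = s @: A :\: s @: B.
Proof.
apply/setP=> x; rewrite -[x](permKV s) inE !mem_imset ?inE //; exact: perm_inj.
Qed.

Lemma imset_permM (s t : 'S_n) A : (s * t)%g @: A = t @: (s @: A).
Proof. by rewrite -imset_comp; apply: eq_imset => x; rewrite /= permM. Qed.

Lemma imset_perm1 A : (1%g : 'S_n) @: A = A.
Proof. by rewrite -[RHS]imset_id; apply: eq_imset => x; rewrite perm1. Qed.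

Lemma SymS A B : A \subset B -> Sym A \subset Sym B.
Proof.
move=> sAB; apply/subsetP=> s /SymP sA; apply/SymP=> x xB; apply: sA.
by apply: contra xB; apply: subsetP.
Qed.

Lemma tperm_Sym A x y : x \in A -> y \in A -> tperm x y \in Sym A.
Proof.
by move=> xA yA; apply/SymP=> z; case: tpermP => // ->; rewrite ?xA ?yA.
Qed.

Lemma SymJ A s : (Sym A :^ s)%g = Sym (s @: A).
Proof.
apply/setP=> t; rewrite mem_conjg; apply/SymP/SymP=> H x xA.
  have: (t ^ s^-1)%g (s^-1 x)%g = (s^-1 x)%g.
    by apply: H; apply: contra xA => xA; apply/imsetP; exists (s^-1 x)%g; rewrite ?permKV.
  by rewrite conjgE invgK !permM permKV => /(congr1 s); rewrite !permKV.
rewrite conjgE invgK !permM H ?permK //.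
by apply: contra xA => /imsetP[y yA /perm_inj ->].
Qed.

Lemma savgMl A s : s \in Sym A -> rho s * savg A = savg A.
Proof. exact: (@gavgMl _ _ G (Sym_group A)). Qed.
Lemma savgMr A s : s \in Sym A -> savg A * rho s = savg A.
Proof. exact: (@gavgMr _ _ G (Sym_group A)). Qed.
Lemma savg_fixl A Z : (forall s, s \in Sym A -> rho s * Z = Z) -> savg A * Z = Z.
Proof. exact: (@gavg_fixl _ _ G (Sym_group A)). Qed.
Lemma savg_fixr A Z : (forall s, s \in Sym A -> Z * rho s = Z) -> Z * savg A = Z.
Proof. exact: (@gavg_fixr _ _ G (Sym_group A)). Qed.
Lemma savg_absl A B : A \subset B -> savg A * savg B = savg B.
Proof. by move/SymS; apply: (@gavg_absl _ _ G (Sym_group A) (Sym_group B)). Qed.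
Lemma savg_absr A B : A \subset B -> savg B * savg A = savg B.
Proof. by move/SymS; apply: (@gavg_absr _ _ G (Sym_group A) (Sym_group B)). Qed.

Lemma savgJ A s : savg A * rho s = rho s * savg (s @: A).
Proof. by rewrite /savg gavgJ SymJ. Qed.

Lemma savg_commute A s : s @: A = A -> savg A * rho s = rho s * savg A.
Proof. by rewrite savgJ => ->. Qed.

Lemma disjoint_stable A B s : [disjoint A & B] -> s \in Sym B -> s @: A = A.
Proof.
move=> /pred0P dAB /SymP sB; rewrite -[RHS]imset_id; apply: eq_in_imset => x xA.
by apply: sB; apply/negP=> xB; have:= dAB x; rewrite /= xA xB.
Qed.

Lemma savgC A B : [disjoint A & B] -> savg A * savg B = savg B * savg A.
Proof.
move=> dAB; apply: (@gavg_comm _ _ G (Sym_group B)) => s sB.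
by rewrite savg_commute // (disjoint_stable dAB).
Qed.

(** By induction on A :\: B: transpose a point of A outside B with a point of B
    outside A. *)
Lemma Sym_move N A B : A \subset N -> B \subset N -> #|A| = #|B| ->
  exists2 s, s \in Sym N & s @: A = B.
Proof.
have [k] := ubnP #|A :\: B|; elim: k A => // k IH A leAB sAN sBN eqAB.
have [sAB | ] := boolP (A \subset B).
  exists 1%g; first by rewrite group1.
  have -> : A = B by apply/eqP; rewrite eqEcard sAB eqAB leqnn.
  by rewrite -[RHS]imset_id; apply: eq_imset => x; rewrite perm1.
move=> nAB; have [x xA xB] := subsetPn nAB.
have [y yB yA] : exists2 y, y \in B & y \notin A.
  apply/subsetPn; apply: contra nAB => sBA.
  by have -> : A = B by apply/eqP; rewrite eq_sym eqEcard sBA eqAB leqnn.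
have tN : tperm x y \in Sym N 
  by apply: tperm_Sym; [apply: (subsetP sAN) | apply: (subsetP sBN)].
have lt_t : (#|(tperm x y @: A) :\: B| < k)%N.
  rewrite -ltnS; apply: leq_trans leAB; rewrite ltnS; apply: proper_card.
  apply/properP; split.
    apply/subsetP=> z; rewrite !inE => /andP[zB /imsetP[w wA wz]]; move: zB.
    rewrite wz; case: tpermP wA => [_ _ | -> | _ _ -> ->] //.
      by rewrite yB.
    by rewrite (negPf yA).
  exists x; first by rewrite inE xB.
  rewrite !inE xB /=; apply/negP=> /imsetP[w wA]; case: tpermP wA.
  - by move=> _ _ xy; rewrite xy yB in xB.
  - by move=> ->; rewrite (negPf yA).
  - by move=> wx _ _ xw; case: wx.
have stN : tperm x y @: A \subset N.
  by rewrite -(Sym_stable tN) imsetS.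
have eq_t : #|tperm x y @: A| = #|B| by rewrite card_imset //; apply: perm_inj.
have [s sN sAB] := IH _ lt_t stN sBN eq_t.
exists (tperm x y * s)%g; first exact: groupM.
by rewrite -sAB -imset_comp; apply: eq_imset => z; rewrite permM.
Qed.

Lemma savg_small A : (#|A| <= 1)%N -> savg A = 1.
Proof.
move=> leA; rewrite /savg; suff -> : Sym A = [set 1%g].
  by rewrite gavgE cards1 invr1 scale1r big_set1 gelt1.
have := trivg_card_le1 (Sym_group A).
by rewrite /= card_Sym; case: #|A| leA => [|[|]] // _ /eqP.
Qed.

(** Multiplying by savg (N :\ c) on the left forgets where a permutation of N
    sends the points other than c. *)
Lemma savg_coset N c s t : s \in Sym N -> t \in Sym N -> s c = t c ->
  savg (N :\ c) * rho s = savg (N :\ c) * rho t.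
Proof.
move=> sN tN st.
rewrite -[s](mulgKV t) geltM mulrA savgMr //.
apply/SymP=> x; rewrite !inE negb_and negbK permM => /orP[/eqP-> | xN].
  by rewrite st permK.
by rewrite (SymP _ _ sN) // -{1}[x](SymP _ _ tN) // permK.
Qed.

(** Right multiplication by a permutation of N permutes the terms of the sum,
    so that the sum absorbs savg N, while each term multiplied by savg N is
    savg N. *)
Lemma savg_transversal N c : c \in N ->
  \sum_(y in N) savg (N :\ c) * rho (tperm c y) = #|N|%:R *: savg N.
Proof.
move=> cN; set Z := LHS.
suff <-: Z * savg N = Z.
  rewrite mulr_suml (eq_bigr (fun=> savg N)) ?sumr_const ?scaler_nat // => y yN.
  by rewrite -mulrA savgMl ?tperm_Sym // savg_absl ?subD1set.
apply: savg_fixr => s sN; rewrite mulr_suml [RHS](reindex_inj (@perm_inj _ s)) /=.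
have memN y : (s y \in N) = (y \in N).
  by rewrite -{1}(Sym_stable sN) mem_imset //; apply: perm_inj.
apply: eq_big => [y|y yN]; first by rewrite memN.
rewrite -mulrA -geltM; apply: savg_coset; rewrite ?tperm_Sym ?groupM ?memN ?tperm_Sym //.
by rewrite permM !tpermL.
Qed.

Lemma savg_coset_r N c s t : s \in Sym N -> t \in Sym N ->
  (s^-1 c = t^-1 c)%g -> rho s * savg (N :\ c) = rho t * savg (N :\ c).
Proof.
move=> sN tN st; rewrite -[s](mulKVg t) geltM -mulrA savgMl //.
apply/SymP=> x; rewrite !inE negb_and negbK permM => /orP[/eqP-> | xN].
  by rewrite -st permKV.
have tx := SymP _ _ tN _ xN.
by rewrite -{1}tx permK (SymP _ _ sN).
Qed.

(** The mirror image of [savg_transversal], where permutations of N are sorted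
    by the point that they send to c. *)
Lemma savg_transversal_r N c : c \in N ->
  \sum_(y in N) rho (tperm c y) * savg (N :\ c) = #|N|%:R *: savg N.
Proof.
move=> cN; set Z := LHS.
suff <-: savg N * Z = Z.
  rewrite mulr_sumr (eq_bigr (fun=> savg N)) ?sumr_const ?scaler_nat // => y yN.
  by rewrite mulrA savgMr ?tperm_Sym // savg_absr ?subD1set.
apply: savg_fixl => s sN.
rewrite mulr_sumr [RHS](reindex_inj (@perm_inj _ s^-1%g)) /=.
have memN y : ((s^-1)%g y \in N) = (y \in N).
  by rewrite -{1}(Sym_stable (groupVr sN)) mem_imset //; apply: perm_inj.
apply: eq_big => [y|y yN]; first by rewrite memN.
rewrite mulrA -geltM; apply: savg_coset_r; rewrite ?tperm_Sym ?groupM ?memN ?tperm_Sym //.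
by rewrite invMg permM !tpermV !tpermL.
Qed.
End SymmetricAverages.

(** * Star words and shuffles *)

Section StarWords.
Variables (R : realType) (n : nat) (G : group_algebra R {perm 'I_n}) (c : 'I_n).
Hypothesis c0 : c = 0%N :> nat.
Implicit Types (A B N X : {set 'I_n}) (s : 'S_n) (t m k l : nat).

Local Notation rho := (gelt G).
Local Notation savg := (savg G).

Definition lz (a b : 'I_n) (p : R) : G := p *: rho (tperm a b) + (1 - p) *: rho 1%g.

(** Bounding the length, rather than prescribing it, lets the bounds of all
    constructions be rounded up freely. *)
Definition star_word (k : nat) (Z : G) : Prop :=
  exists ws : seq (lazy_transposition R n),
    [/\ (size ws <= k)%N, all (@is_star R n) ws &
        Z = \prod_(T <- ws) lz (lazy_fst T) (lazy_snd T) (lazy_prob T)].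

Lemma star_word1 : star_word 0 1.
Proof. by exists [::]; rewrite big_nil. Qed.

Lemma star_word_le k l Z : (k <= l)%N -> star_word k Z -> star_word l Z.
Proof. by move=> kl [ws [sz st ->]]; exists ws; split=> //; apply: leq_trans kl. Qed.

Lemma star_wordM k l Y Z :
  star_word k Y -> star_word l Z -> star_word (k + l) (Y * Z).
Proof.
move=> [u [uk us ->]] [v [vl vs ->]]; exists (u ++ v).
by rewrite size_cat leq_add // all_cat us vs big_cat.
Qed.

Lemma star_word_lz b p : b != c -> 0 <= p <= 1 -> star_word 1 (lz c b p).
Proof.
move=> bc p01; rewrite eq_sym in bc; exists [:: LazyTransposition bc p01].
by rewrite big_seq1 /= /is_star /= c0 eqxx.
Qed.

Lemma lz1 a b : lz a b 1 = rho (tperm a b).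
Proof. by rewrite /lz subrr scale0r addr0 scale1r. Qed.

Lemma star_word_tperm b : b != c -> star_word 1 (rho (tperm c b)).
Proof. by move=> bc; rewrite -lz1; apply: star_word_lz; rewrite ?ler01 ?lexx. Qed.

Lemma lzJ a b p s : lz a b p * rho s = rho s * lz (s a) (s b) p.
Proof.
rewrite /lz mulrDl mulrDr -!scalerAl -!scalerAr -!geltM mul1g mulg1.
by rewrite conjgC tpermJ.
Qed.

Lemma lzC a b p : lz a b p = lz b a p.
Proof. by rewrite /lz tpermC. Qed.

Lemma tperm_lz a b p : rho (tperm a b) * lz a b p = lz a b (1 - p).
Proof.
rewrite /lz mulrDr -!scalerAr -!geltM tperm2 mulg1 addrC.
by congr (_ + _ *: _); ring.
Qed.

Lemma lz_savg N a b p : a \in N -> b \in N -> lz a b p * savg N = savg N.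
Proof.
move=> aN bN; rewrite /lz mulrDl -!scalerAl savgMl ?tperm_Sym // gelt1 mul1r.
by rewrite -scalerDl addrC subrK scale1r.
Qed.

Lemma lz_savgC B a b p : [disjoint B & [set a; b]] ->
  savg B * lz a b p = lz a b p * savg B.
Proof.
move=> dB; rewrite mulrDl mulrDr -!scalerAl -!scalerAr gelt1 mulr1 mul1r.
congr (_ *: _ + _); apply: savg_commute; apply: disjoint_stable dB _.
by apply: tperm_Sym; rewrite !inE eqxx ?orbT.
Qed.

(** Conjugate (c b) by (c a): the content of c returns to its place. *)
Lemma star_word_lz3 a b p : a != b -> 0 <= p <= 1 -> star_word 3 (lz a b p).
Proof.
move=> ab p01; have [ac|ac] := eqVneq a c.
  rewrite ac; apply: (@star_word_le 1) => //.
  by apply: star_word_lz; rewrite // -ac eq_sym.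
have [bc|bc] := eqVneq b c.
  by rewrite bc lzC; apply: (@star_word_le 1) => //; apply: star_word_lz.
have -> : lz a b p = rho (tperm c a) * lz c b p * rho (tperm c a).
  rewrite -[_ * _ * _]mulrA lzJ tpermL tpermD // 1?eq_sym // mulrA -geltM.
  by rewrite tperm2 gelt1 mul1r.
apply: (@star_wordM 2 1); last exact: star_word_tperm.
by apply: (@star_wordM 1 1); [apply: star_word_tperm | apply: star_word_lz].
Qed.

(** Relabelling the positions other than the centre keeps star transpositions
    star transpositions. *)
Lemma star_wordJ k Z s : s c = c -> star_word k Z ->
  star_word k (rho s^-1 * Z * rho s).
Proof.
move=> sc [ws [sz st ->]].
elim: ws k sz st => [|T ws IH] k sz st.
  exists [::]; split=> //; by rewrite !big_nil mulr1 -geltM mulVg gelt1.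
case: k sz => // k sz; have /= /andP[Tst wst] := st.
have [us [usz ust usE]] := IH k sz wst.
have neq : s (lazy_fst T) != s (lazy_snd T).
  by rewrite (inj_eq perm_inj) lazy_neq.
exists (LazyTransposition neq (lazy_prob01 T) :: us); split=> //=.
  rewrite ust andbT; move: Tst; rewrite /is_star /= -c0 !val_eqE.
  by rewrite -{3 4}sc !(inj_eq perm_inj).
rewrite !big_cons /= -usE !mulrA; congr (_ * _ * _).
by rewrite -[LHS]mulr1 -(geltKV G s) mulrA -[_ * rho s]mulrA lzJ mulrA geltVK mul1r.
Qed.

(** Nothing is asked of what started outside X: the factor savg (N :\: X)
    randomizes it beforehand. *)
Definition shuffles (k : nat) X N : Prop :=
  exists2 Z, star_word k Z & savg (N :\: X) * Z = savg N.

Lemma shuffles_le k l X N : (k <= l)%N -> shuffles k X N -> shuffles l X N.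
Proof. by move=> kl [Z /(star_word_le kl) Zk eZ]; exists Z. Qed.

(** Uniformity over all X and N of given sizes is what makes the bounds
    composable: the centre c may lie in X, in N \ X or outside N. *)
Definition shuffle_cost (t m k : nat) : Prop :=
  forall X N, X \subset N -> #|X| = t -> #|N| = m -> shuffles k X N.

Lemma savgVJ A s : savg (s @: A) * rho s^-1 = rho s^-1 * savg A.
Proof.
rewrite savgJ -imset_comp; congr (_ * savg _); rewrite -[RHS]imset_id.
by apply: eq_imset => x; rewrite /= permK.
Qed.

(** A word for one pair (X, N) gives a word for any other pair of the same
    sizes: relabel by a permutation that fixes the centre, and repair the
    place of the centre by a star transposition before and after. *)
Lemma shuffle_cost_of_one X N k :
  X \subset N -> shuffles k X N -> shuffle_cost #|X| #|N| (k + 2).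
Proof.
move=> sXN [Z Zk eZ] X2 N2 sXN2 eqX eqN.
have [s _ sN] := @Sym_move _ [set: 'I_n] N N2 (subsetT _) (subsetT _) (esym eqN).
have sXs : s @: X \subset N2 by rewrite -sN imsetS.
have eqXs : #|s @: X| = #|X2| by rewrite card_imset //; apply: perm_inj.
have [s' s'N s'X] := Sym_move sXs sXN2 eqXs.
pose u := (s * s')%g.
have uX : u @: X = X2.
  by rewrite -s'X -imset_comp; apply: eq_imset => z; rewrite /= permM.
have uN : u @: N = N2.
  rewrite -(Sym_stable s'N) -sN -imset_comp; apply: eq_imset => z.
  by rewrite /= permM.
have uD : u @: (N :\: X) = N2 :\: X2.
  by rewrite -uX -uN imset_permD.
(* u maps (X, N) to (X2, N2); v differs from it only in fixing the centre. *)
pose v := (u * tperm (u c) c)%g.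
have vc : v c = c by rewrite permM tpermL.
have vK : u = (v * tperm (u c) c)%g by rewrite -mulgA tperm2 mulg1.
exists (rho u^-1 * Z * rho u); last first.
  rewrite -uD !mulrA savgVJ -[_ * savg _ * Z]mulrA eZ -mulrA savgJ mulrA geltVK.
  by rewrite mul1r uN.
have tw : star_word 1 (rho (tperm (u c) c)).
  have [-> | ucc] := eqVneq (u c) c; last by rewrite tpermC; apply: star_word_tperm.
  by rewrite tperm1 gelt1; apply: star_word_le star_word1.
have -> : rho u^-1 * Z * rho u =
    rho (tperm (u c) c) * (rho v^-1 * Z * rho v) * rho (tperm (u c) c).
  by rewrite [in LHS]vK invMg tpermV !geltM !mulrA.
have := star_wordM (star_wordM tw (star_wordJ vc Zk)) tw.
by rewrite addn1 add1n addn2.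
Qed.

Lemma shuffle_cost0 m : shuffle_cost 0 m 0.
Proof.
move=> X N _ /cards0_eq-> _; exists 1; first exact: star_word1.
by rewrite setD0 mulr1.
Qed.

Lemma shuffle_cost_le t m k l :
  (k <= l)%N -> shuffle_cost t m k -> shuffle_cost t m l.
Proof. by move=> kl cost X N sXN eX eN; apply: shuffles_le kl _; apply: cost. Qed.

(** If Z spreads X :\: Y over N :\: Y and W spreads Y over N, then
    savg (N :\: X) * Z * W = savg (N :\: Y) * W = savg N. *)
Lemma shuffle_costD (s t m k l : nat) :
  shuffle_cost t m k -> shuffle_cost s (m + s) l ->
  shuffle_cost (t + s) (m + s) (k + l).
Proof.
move=> cost_t cost_s X N sXN eX eN.
have [Y sYX eY] : exists2 Y : {set 'I_n}, Y \subset X & #|Y| = s.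
  have : (0 < #|[set Y : {set 'I_n} | Y \subset X & #|Y| == s]|)%N.
    by rewrite cards_draws bin_gt0 eX leq_addl.
  by case/card_gt0P=> Y; rewrite inE => /andP[sYX /eqP]; exists Y.
have sYN := subset_trans sYX sXN.
have [W Wl eW] := cost_s Y N sYN eY eN.
have eXY : #|X :\: Y| = t by rewrite cardsD (setIidPr sYX) eX eY addnK.
have eNY : #|N :\: Y| = m by rewrite cardsD (setIidPr sYN) eN eY addnK.
have [Z Zk eZ] := cost_t _ _ (setSD _ sXN) eXY eNY.
exists (Z * W); first exact: star_wordM.
rewrite mulrA -eW -eZ; congr (savg _ * _ * _).
apply/setP=> x; rewrite !inE; case: (boolP (x \in Y)) => [xY|] //=.
by rewrite (subsetP sYX).
Qed.

Lemma sweep_weight r : (1 - r.+2%:R^-1) * r.+1%:R^-1 = r.+2%:R^-1 :> R.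
Proof.
have r0 : r.+1%:R != 0 :> R by rewrite pnatr_eq0.
apply: (mulIf r0); rewrite mulfVK //.
have : r.+2%:R^-1 * r.+2%:R = 1 :> R by rewrite mulVf ?pnatr_eq0.
by rewrite -(natr1 r.+1) mulrDr mulr1 => /(canRL (addrK _)) ->.
Qed.

Section Sweep.
Variable N : {set 'I_n}.
Hypothesis cN : c \in N.
Let f y := savg (N :\ c) * rho (tperm c y).

(** Here f y is the uniform law on the permutations of N that send c to y.  A
    counter that was dropped at y is not disturbed by the later steps of a
    sweep. *)
Lemma sweep_stay y b p : y \in N -> b \in N -> y != c -> y != b ->
  f y * lz c b p = f y.
Proof.
move=> yN bN yc yb; rewrite /lz mulrDr -!scalerAr gelt1 mulr1.
suff -> : f y * rho (tperm c b) = f y by rewrite -scalerDl addrC subrK scale1r.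
rewrite -mulrA -geltM; apply: savg_coset; rewrite ?groupM ?tperm_Sym //.
by rewrite permM tpermL tpermD // eq_sym.
Qed.

Lemma sweep_drop b p : f c * lz c b p = p *: f b + (1 - p) *: f c.
Proof.
by rewrite /f /lz tperm1 gelt1 mulr1 mulrDr -!scalerAr mulr1.
Qed.

(** The counter in c is dropped at the first of r + 1 remaining places with
    probability 1 / (r + 2), the last share being its chance to stay in c. *)
Lemma sweep bs : uniq bs -> c \notin bs -> {subset bs <= N} ->
  exists Z, [/\ star_word (size bs) Z,
    forall y, y \in N -> y != c -> y \notin bs -> f y * Z = f y &
    f c * Z = (size bs).+1%:R^-1 *: \sum_(y <- c :: bs) f y].
Proof.
elim: bs => [_ _ _|b bs IH /= /andP[bbs ubs]].
  exists 1; split=> [|y _ _ _|]; rewrite ?mulr1 //; first exact: star_word1.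
  by rewrite big_seq1 invr1 scale1r.
rewrite inE negb_or => /andP[cb cbs] sbs.
have bN : b \in N by rewrite sbs ?mem_head.
have sbs' : {subset bs <= N} by move=> x xbs; apply: sbs; rewrite inE xbs orbT.
have [Z [Zk Zf Zc]] := IH ubs cbs sbs'.
pose p : R := (size bs).+2%:R^-1.
have p01 : 0 <= p <= 1 by rewrite invr_ge0 ler0n invf_le1 ?ler1n ?ltr0n.
exists (lz c b p * Z); split=> [|y yN yc|].
- by apply: (@star_wordM 1) => //; apply: star_word_lz; rewrite // eq_sym.
- by rewrite inE negb_or => /andP[yb ybs]; rewrite mulrA sweep_stay // Zf.
rewrite mulrA sweep_drop mulrDl -!scalerAl Zf // 1?eq_sym // Zc scalerA.
have -> : (1 - p) * (size bs).+1%:R^-1 = p.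
  exact: sweep_weight.
by rewrite -scalerDr !big_cons addrCA.
Qed.

Lemma savg_sweep : savg N = #|N|%:R^-1 *: \sum_(y in N) f y.
Proof.
rewrite savg_transversal // scalerA mulVf ?scale1r // pnatr_eq0 -lt0n.
by apply/card_gt0P; exists c.
Qed.

(** If x is not the centre, the first step of the sweep also has to fetch the
    counter.  As (c x) followed by the lazy transposition (c, x, p) is the lazy
    transposition (c, x, 1 - p), this takes no additional step. *)
Lemma insertion x : x \in N -> shuffles #|N|.-1 [set x] N.
Proof.
move=> xN; have [-> | xc] := eqVneq x c.
  have [||y|Z [Zk _ Zc]] := @sweep (enum (N :\ c)).
  - exact: enum_uniq.
  - by rewrite mem_enum !inE eqxx.
  - by rewrite mem_enum => /setD1P[].
  have sz : size (enum (N :\ c)) = #|N|.-1 by rewrite -cardE (cardsD1 c N) cN.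
  exists Z; first by rewrite -sz.
  rewrite -[savg _](mulr1) -gelt1 -(tperm1 c) Zc sz savg_sweep (big_setD1 c) //=.
  by rewrite big_cons big_enum /= prednK // (cardsD1 c N) cN.
have [||y|Z [Zk Zf Zc]] := @sweep (enum (N :\ c :\ x)).
- exact: enum_uniq.
- by rewrite mem_enum !inE eqxx andbF.
- by rewrite mem_enum !inE => /and3P[].
have cardN : #|N| = (size (enum (N :\ c :\ x))).+2.
  by rewrite -cardE (cardsD1 c N) cN (cardsD1 x (N :\ c)) !inE xc xN.
set r := size _ in Zk Zc cardN.
pose p : R := r.+2%:R^-1.
have p01 : 0 <= 1 - p <= 1.
  by rewrite subr_ge0 gerBl invr_ge0 ler0n invf_le1 ?ler1n ?ltr0n.
exists (lz c x (1 - p) * Z).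
  by rewrite cardN; apply: (@star_wordM 1); first exact: star_word_lz.
rewrite -tperm_lz !mulrA savgJ.
have tN : tperm c x \in Sym N by rewrite tperm_Sym.
have -> : tperm c x @: (N :\: [set x]) = N :\ c.
  by rewrite imset_permD (Sym_stable tN) imset_set1 tpermR.
rewrite -(savgMl _ tN) -!mulrA; congr (_ * _).
rewrite -[savg _](mulr1) -gelt1 -(tperm1 c) mulrA -/(f c) sweep_drop.
rewrite mulrDl -!scalerAl Zf //; last by rewrite mem_enum !inE eqxx.
rewrite Zc scalerA savg_sweep (big_setD1 c) //= (big_setD1 x) ?inE ?xc //=.
rewrite big_cons big_enum /= cardN -/p.
have -> : (1 - p) * r.+1%:R^-1 = p.
  exact: sweep_weight.
by rewrite -scalerDr addrCA.
Qed.
End Sweep.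

Section Extension.
Variables (N : {set 'I_n}) (d : 'I_n).
Hypothesis dN : d \notin N.
Let h y := rho (tperm d y) * savg N.

(** Here h y brings the content of y to d and then applies a uniform
    permutation of N: it is the uniform law on the permutations of d |: N that
    send y to d. *)
Lemma extend_sum : #|N|.+1%:R *: savg (d |: N) = \sum_(y in d |: N) h y.
Proof.
have := @savg_transversal_r R n G (d |: N) d (setU11 _ _).
by rewrite setU1K // cardsU1 dN add1n => <-.
Qed.

Lemma extend_stay x y p : x \in N -> y \in N -> x != y -> 
  lz d x p * h y = h y.
Proof.
move=> xN yN xy; rewrite /h mulrA.
have -> : lz d x p * rho (tperm d y) = rho (tperm d y) * lz y x p.
  rewrite lzJ tpermL tpermD // 1?eq_sym //.
  by apply: contraNneq dN => <-.
by rewrite -mulrA lz_savg.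
Qed.

Lemma extend_pick x p : lz d x p * h d = p *: h x + (1 - p) *: h d.
Proof. by rewrite /h /lz tperm1 gelt1 mul1r mulrDl -!scalerAl mul1r. Qed.

(** The counters of xs compete for the new position d.  The transpositions are
    listed so that the one of the head of xs acts last on the factor h d, hence
    its probability is the reciprocal of the number of candidates left. *)
Lemma extend_picks xs : uniq xs -> {subset xs <= N} -> exists V,
  [/\ star_word (3 * size xs) V,
      forall B, [disjoint B & d |: [set x in xs]] -> savg B * V = V * savg B,
      forall y, y \in N -> y \notin xs -> V * h y = h y &
      V * h d = #|N|.+1%:R^-1 *:
        (\sum_(x <- xs) h x + (#|N|.+1 - size xs)%:R *: h d)].
Proof.
elim: xs => [|x xs IH] /=.
  move=> _ _; exists 1; split=> [|B _|y _ _|]; rewrite ?mulr1 ?mul1r //.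
    exact: star_word1.
  by rewrite big_nil add0r subn0 scalerA mulVf ?scale1r ?pnatr_eq0.
move=> /andP[xxs uxs] sxs; have xN : x \in N by rewrite sxs ?mem_head.
have sxs' : {subset xs <= N} by move=> y yxs; apply: sxs; rewrite inE yxs orbT.
have [V [Vk VB Vf Vd]] := IH uxs sxs'.
have szN : (size xs < #|N|)%N.
  have <- : #|x :: xs| = (size xs).+1 by apply/card_uniqP; rewrite /= xxs.
  by apply/subset_leq_card/subsetP.
have dx : d != x by apply: contraNneq dN => ->.
pose p : R := (#|N|.+1 - size xs)%:R^-1.
have p01 : 0 <= p <= 1 by rewrite invr_ge0 ler0n invf_le1 ?ler1n ?ltr0n; lia.
exists (lz d x p * V); split=> [|B|y yN|].
- by rewrite mulnS; apply: star_wordM => //; apply: star_word_lz3.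
- move=> dB; rewrite -mulrA -VB ?mulrA; last first.
    apply: disjointWr dB; apply/subsetP=> z; rewrite !inE.
    by case/orP=> [-> | ->]; rewrite ?orbT.
  by rewrite lz_savgC //; apply: disjointWr dB; apply/subsetP=> z;
    rewrite !inE => /orP[|]/eqP->; rewrite eqxx ?orbT.
- rewrite inE negb_or => /andP[yx yxs].
  by rewrite -mulrA Vf // extend_stay 1?eq_sym.
rewrite -mulrA Vd -scalerAr mulrDr -scalerAr extend_pick big_cons.
congr (_ *: _); rewrite mulr_sumr (eq_big_seq h) => [|y yxs]; last first.
  by apply: extend_stay => //; [exact: sxs' | apply: contraNneq xxs => ->].
have neq0 : (#|N|.+1 - size xs)%:R != 0 :> R by rewrite pnatr_eq0; lia.
have -> : (#|N|.+1 - (size xs).+1)%:R = (#|N|.+1 - size xs)%:R * (1 - p).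
  rewrite mulrBr mulr1 divff //; apply/eqP; rewrite eq_sym subr_eq natr1.
  by rewrite subnSK // ltnS ltnW.
by rewrite scalerDr !scalerA divff // scale1r addrCA addrA.
Qed.

(** The picks give each counter of X its share of the position d, and the
    average over (d |: N) :\: X gives every other point the same share.  The
    factor W allows for a permutation that is absorbed only once N has been
    extended. *)
Lemma extend_by X k Z W : X \subset N -> star_word k Z ->
    savg (N :\: X) * Z = savg N * W ->
  exists2 Z', star_word (3 * #|X| + k) Z' &
    savg ((d |: N) :\: X) * Z' = savg (d |: N) * W.
Proof.
move=> sXN Zk eZ.
have [||V [Vk VB _ Vd]] := @extend_picks (enum X).
- exact: enum_uniq.
- by move=> x; rewrite mem_enum; apply: (subsetP sXN).
rewrite -cardE in Vk Vd; exists (V * Z); first exact: star_wordM.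
have sD : N :\: X \subset (d |: N) :\: X by rewrite setSD // subsetU1.
rewrite -(savg_absr G sD) -!mulrA (mulrA _ V) VB; last first.
  rewrite disjoint_sym disjoints_subset; apply/subsetP=> x; rewrite !inE mem_enum.
  by case/orP=> [/eqP-> | ->]; rewrite ?(negPf dN) ?andbF.
rewrite -mulrA eZ !mulrA; congr (_ * W); rewrite -mulrA.
have -> : savg N = h d by rewrite /h tperm1 gelt1 mul1r.
rewrite Vd -scalerAr -[RHS](@savg_absl R n G ((d |: N) :\: X)) ?subsetDl //.
have -> : savg (d |: N) = #|N|.+1%:R^-1 *: \sum_(y in d |: N) h y.
  by rewrite -extend_sum scalerA mulVf ?scale1r ?pnatr_eq0.
rewrite -scalerAr; congr (_ *: _); rewrite mulrDr mulr_sumr.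
rewrite [in RHS]mulr_sumr [RHS](big_setID X) /=.
rewrite (setIidPr (subset_trans sXN (subsetUr _ _))) big_enum /=; congr (_ + _).
rewrite (eq_bigr (fun=> savg ((d |: N) :\: X) * h d)) => [|y yD]; last first.
  rewrite /h tperm1 gelt1 mul1r mulrA savgMr // tperm_Sym //.
  rewrite !inE eqxx andbT; apply: contra dN; exact: (subsetP sXN).
rewrite sumr_const -scalerAr scaler_nat; congr (_ *+ _).
rewrite cardsD cardsU1 dN (setIidPr (subset_trans sXN (subsetUr _ _))).
by rewrite add1n.
Qed.

Lemma extend_shuffle X k : X \subset N -> shuffles k X N ->
  shuffles (3 * #|X| + k) X (d |: N).
Proof.
move=> sXN [Z Zk eZ]; have [|Z' Z'k eZ'] := @extend_by X k Z 1 sXN Zk.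
  by rewrite mulr1.
by exists Z' => //; rewrite eZ' mulr1.
Qed.

End Extension.

(** Two star transpositions more than [insertion], for the sets that do not
    contain the centre. *)
Lemma shuffle_cost1 m : shuffle_cost 1 m m.+1.
Proof.
move=> X N sXN /eqP/cards1P[a eX] eN; subst X.
pose A := tperm a c @: N.
have aN : a \in N by rewrite -sub1set.
have cA : c \in A by apply/imsetP; exists a; rewrite ?tpermL.
have eA : #|A| = m by rewrite card_imset //; apply: perm_inj.
have m0 : (0 < m)%N by rewrite -eN; apply/card_gt0P; exists a.
have sc : [set c] \subset A by rewrite sub1set.
have := shuffle_cost_of_one sc (insertion cA cA).
rewrite cards1 eA addn2 prednK //; apply=> //; exact: cards1.
Qed.

Lemma shuffle_cost_insert t m : shuffle_cost t m (t * m.+1).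
Proof.
elim: t m => [|t IH] m; first exact: shuffle_cost0.
case: m => [|m].
  move=> X N sXN eX /cards0_eq eN; move: sXN eX.
  by rewrite eN subset0 => /eqP->; rewrite cards0.
have := shuffle_costD (IH m) (@shuffle_cost1 (m + 1)%N).
by rewrite !addn1; apply: shuffle_cost_le; lia.
Qed.

Lemma shuffle_cost_extend t m k : (t <= m)%N -> shuffle_cost t m k ->
  shuffle_cost t m.+1 (3 * t + k).
Proof.
move=> tm cost X N sXN eX eN.
have [d dN dX] : exists2 d, d \in N & d \notin X.
  by apply/subsetPn; apply/negP=> /subset_leq_card; rewrite eX eN leqNgt ltnS tm.
have sXd : X \subset N :\ d by rewrite subsetD1 sXN.
have eNd : #|N :\ d| = m by move: eN; rewrite (cardsD1 d) dN => -[].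
have dNd : d \notin N :\ d by rewrite !inE eqxx.
by have := extend_shuffle dNd sXd (cost _ _ sXd eX eNd); rewrite setD1K // eX.
Qed.

End StarWords.

Section Placements.
Variables (R : realType) (n : nat) (G : group_algebra R {perm 'I_n}).
Local Notation rho := (gelt G).

Lemma prod_gelt m (s : 'I_m -> 'S_n) :
  \prod_(j < m) rho (s j) = rho (\prod_(j < m) s j)%g.
Proof.
elim: m s => [|m IH] s; first by rewrite !big_ord0 gelt1.
by rewrite !big_ord_recl IH geltM.
Qed.

Lemma prod_scale m (a : 'I_m -> R) (Z : 'I_m -> G) :
  \prod_(j < m) (a j *: Z j) = (\prod_(j < m) a j) *: \prod_(j < m) Z j.
Proof.
elim: m a Z => [|m IH] a Z; first by rewrite !big_ord0 scale1r.
by rewrite !big_ord_recl IH -scalerAl -scalerAr scalerA.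
Qed.

Lemma lz_law (T : lazy_transposition R n) :
  lz G (lazy_fst T) (lazy_snd T) (lazy_prob T) = \sum_s lazy_law T s *: rho s.
Proof.
rewrite /lz /lazy_law; under eq_bigr do rewrite scalerDl.
rewrite big_split /=; congr (_ + _).
  rewrite (bigD1 (tperm (lazy_fst T) (lazy_snd T))) //= eqxx mulr1.
  by rewrite big1 ?addr0 // => s /negPf->; rewrite mulr0 scale0r.
rewrite (bigD1 1%g) //= eqxx mulr1.
by rewrite big1 ?addr0 // => s /negPf->; rewrite mulr0 scale0r.
Qed.

Definition word_law m (Ts : m.-tuple (lazy_transposition R n)) (g : 'S_n) : R :=
  \sum_(s : {ffun 'I_m -> 'S_n} | (\prod_(j < m) s j)%g == g)
    \prod_(j < m) lazy_law (tnth Ts j) (s j).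

Lemma prod_lz_law m (Ts : m.-tuple (lazy_transposition R n)) :
  \prod_(T <- Ts) lz G (lazy_fst T) (lazy_snd T) (lazy_prob T) =
  \sum_g word_law Ts g *: rho g.
Proof.
rewrite big_tuple; under eq_bigr do rewrite lz_law.
rewrite bigA_distr_bigA /=; under eq_bigr do rewrite prod_scale prod_gelt.
rewrite (partition_big (fun s : {ffun 'I_m -> 'S_n} => (\prod_(j < m) s j)%g) xpredT) //=.
apply: eq_bigr => g _; rewrite scaler_suml.
by apply: eq_bigr => s /eqP ->.
Qed.

Lemma extend_injection t (le_tn : (t <= n)%N) (f : {ffun 'I_t -> 'I_n}) :
  injective f -> exists h : 'S_n, forall i, h (widen_ord le_tn i) = f i.
Proof.
move=> injf; (* The values of f in order, then the points outside its range. *)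
pose L := codom f ++ enum [predC codom f].
have szL : size L = n.
  by rewrite size_cat -cardE size_codom -(card_codom injf) cardC card_ord.
have uL : uniq L.
  rewrite cat_uniq enum_uniq andbT; apply/andP; split.
    by rewrite map_inj_uniq ?enum_uniq.
  by apply/hasPn=> x; rewrite mem_enum.
case: (posnP n) => [n0|n_gt0].
  by exists 1%g => i; have := ltn_ord (f i); rewrite [X in (_ < X)%N]n0.
pose x0 := Ordinal n_gt0.
have injL : injective (fun x : 'I_n => nth x0 L x).
  by move=> x y /eqP; rewrite nth_uniq ?szL // => /eqP/val_inj.
exists (perm injL) => i; rewrite permE /= nth_cat size_codom card_ord ltn_ord.
by rewrite (nth_map i) ?size_enum_ord // nth_ord_enum.
Qed.

(** The permutations that realize the placement f form one right coset of the
    pointwise stabilizer K of the starting positions.  The weight of that coset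
    is read off at a single permutation h in it, from the average over K. *)
Lemma shuffle_of_avg t (le_tn : (t <= n)%N) m (Ts : m.-tuple (lazy_transposition R n)) :
  savg G ([set: 'I_n] :\: [set widen_ord le_tn i | i in 'I_t]) *
    \prod_(T <- Ts) lz G (lazy_fst T) (lazy_snd T) (lazy_prob T) =
    savg G [set: 'I_n] ->
  is_shuffle le_tn Ts.
Proof.
set X := [set _ | _ in _] => eq_avg f injf; have [h hf] := extend_injection le_tn injf.
set K := Sym ([set: 'I_n] :\: X).
have cardK : #|K| = (n - t)`!.
  rewrite card_Sym cardsDS ?subsetT // cardsT card_ord card_imset ?card_ord //.
  by move=> i j /(congr1 val) /= /val_inj.
have K0 : #|K|%:R != 0 :> R by rewrite cardK pnatr_eq0 -lt0n fact_gt0.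
have -> : placement_prob le_tn Ts f = \sum_(k in K) word_law Ts (k^-1 * h)%g.
  rewrite /placement_prob.
  pose P (s : {ffun 'I_m -> 'S_n}) := (\prod_(j < m) s j)%g.
  rewrite (partition_big P (fun g => [forall i, g (widen_ord le_tn i) == f i])) /=; last first.
    move=> s /eqP <-; apply/forallP=> i; by rewrite ffunE.
  have inj_kh : injective (fun k : 'S_n => (k^-1 * h)%g).
    by move=> k l /mulIg/invg_inj.
  rewrite (reindex_inj inj_kh) /=.
  have fixK k : [forall i, (k^-1 * h)%g (widen_ord le_tn i) == f i] = (k \in K).
    rewrite -groupV; apply/forallP/SymP => [kf x | kK i].
      rewrite !inE andbT negbK => /imsetP[i _ ->]; apply: (@perm_inj _ h).
      by have:= eqP (kf i); rewrite permM hf.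
    by rewrite permM kK ?hf // !inE andbT negbK imset_f.
  apply: eq_big => [k|k]; first by rewrite fixK.
  rewrite fixK => kK; apply: eq_bigl => s; apply/andP/idP => [[] // | Ps].
  split=> //; apply/eqP/ffunP=> i; rewrite ffunE (eqP Ps).
  by apply/eqP; move: i; apply/forallP; rewrite fixK.
have coefT : gcoef (savg G [set: 'I_n]) h = n`!%:R^-1.
  rewrite /savg gavgE card_Sym cardsT card_ord scaler_sumr.
  rewrite (eq_bigl xpredT) => [|k]; first exact: (gcoefE G (fun=> n`!%:R^-1)).
  by apply/SymP=> x; rewrite inE.
have shift k : rho k * (\sum_g word_law Ts g *: rho g) =
    \sum_g word_law Ts (k^-1 * g)%g *: rho g.
  rewrite mulr_sumr [RHS](reindex_inj (mulgI k)) /=; apply: eq_bigr => g _.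
  by rewrite -scalerAr -geltM mulKg.
have := congr1 (fun Z : G => gcoef Z h) eq_avg.
rewrite /= coefT prod_lz_law /savg gavgE -/K -scalerAl mulr_suml.
rewrite (eq_bigr _ (fun k _ => shift k)).
rewrite exchange_big /=; under eq_bigr do rewrite -scaler_suml.
rewrite scaler_sumr (eq_bigr _ (fun g _ => scalerA _ _ _)).
rewrite (gcoefE G (fun g => #|K|%:R^-1 * \sum_(k in K) word_law Ts (k^-1 * g)%g)).
move=> /(congr1 ( *%R #|K|%:R)); rewrite mulrA divff // mul1r => ->.
rewrite cardK -(bin_fact le_tn) mulnA natrM invfM mulrA mulrAC.
rewrite divff ?mul1r; last by rewrite -cardK.
by rewrite mulnC.
Qed.

Lemma star_shuffle_of_cost t k : (t <= n)%N ->
  shuffle_cost G t n k -> exists2 m, has_star_shuffle R t n m & (m <= k)%N.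
Proof.
move=> le_tn cost.
have cardX : #|[set widen_ord le_tn i | i in 'I_t]| = t.
  by rewrite card_imset ?card_ord // => i j /(congr1 val) /= /val_inj.
have cardT : #|[set: 'I_n]| = n by rewrite cardsT card_ord.
have [Z [ws [wsk st ->]] eZ] := cost _ _ (subsetT _) cardX cardT.
exists (size ws) => //; exists le_tn, (in_tuple ws); split=> //.
by apply: shuffle_of_avg; rewrite -eZ.
Qed.
End Placements.

(** * Grids of triples *)

Definition blk0 := @Ordinal 3 0 isT.
Definition blk1 := @Ordinal 3 1 isT.
Definition blk2 := @Ordinal 3 2 isT.

Section Blocks.
Variables (R : realType) (n : nat) (G : group_algebra R {perm 'I_n}).
Variables (m : nat) (pos : 'I_m -> 'I_3 -> 'I_n).
Hypothesis pos_inj : forall i k j l, pos i k = pos j l -> i = j /\ k = l.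
Implicit Types (S X : {set 'I_n}) (i j : 'I_m) (k l : 'I_3).

Local Notation rho := (gelt G).
Local Notation savg := (savg G).

Definition block k := [set pos i k | i in 'I_m].
Definition triple i := [set pos i k | k in 'I_3].
Definition grid := [set pos p.1 p.2 | p in [set: 'I_m * 'I_3]].

Lemma mem_pos i k l : (pos i k \in block l) = (k == l).
Proof.
apply/imsetP/eqP => [[j _ /pos_inj[]//]|->]; by exists i.
Qed.

Lemma mem_triple i j k : (pos i k \in triple j) = (i == j).
Proof.
apply/imsetP/eqP => [[l _ /pos_inj[]//]|->]; by exists k.
Qed.

Lemma mem_grid i k : pos i k \in grid.
Proof. by apply/imsetP; exists (i, k). Qed.

Lemma gridP x : reflect (exists i k, x = pos i k) (x \in grid).
Proof.
apply: (iffP imsetP) => [[[i k] _ ->]|[i [k ->]]]; first by exists i, k.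
by exists (i, k).
Qed.

Lemma block_grid k : block k \subset grid.
Proof. by apply/subsetP=> _ /imsetP[i _ ->]; apply: mem_grid. Qed.

Lemma triple_grid i : triple i \subset grid.
Proof. by apply/subsetP=> _ /imsetP[k _ ->]; apply: mem_grid. Qed.

Lemma block_disjoint k l : k != l -> [disjoint block k & block l].
Proof.
move=> kl; apply/pred0P=> x /=; apply/negP=> /andP[/imsetP[i _ ->]].
by rewrite mem_pos (negPf kl).
Qed.

Lemma triple_disjoint i j : i != j -> [disjoint triple i & triple j].
Proof.
move=> ij; apply/pred0P=> x /=; apply/negP=> /andP[/imsetP[k _ ->]].
by rewrite mem_triple (negPf ij).
Qed.

Lemma card_block k : #|block k| = m.
Proof. by rewrite card_imset ?card_ord // => i j /pos_inj[]. Qed.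

Lemma card_grid : #|grid| = (3 * m)%N.
Proof.
rewrite /grid card_imset; last by move=> [i k] [j l] /= /pos_inj[-> ->].
by rewrite cardsT card_prod !card_ord mulnC.
Qed.

Lemma swap_image (k l k' : 'I_3) d :
  (forall i x, d (pos i x) = pos i (tperm k l x)) ->
  d @: block k' = block (tperm k l k').
Proof.
move=> dE; rewrite /block -imset_comp; apply: eq_imset => i /=; exact: dE.
Qed.

Definition triple_shuffle (s : seq 'I_m) := \prod_(i <- s) savg (triple i).

Lemma triple_absorb s i t : i \in s -> t \in Sym (triple i) ->
  rho t * triple_shuffle s = triple_shuffle s.
Proof.
move=> si ti; elim: s si => // j s IH; rewrite inE /triple_shuffle big_cons.
have [<- _ | ij /= /IH eq_s] := eqVneq i j; first by rewrite mulrA savgMl.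
rewrite mulrA -savg_commute -?mulrA ?eq_s //.
by apply: disjoint_stable ti; apply: triple_disjoint; rewrite eq_sym.
Qed.

(** Exchanging two blocks is a product of transpositions, one inside each
    triple. *)
Lemma swap_blocks k l : exists d : 'S_n, [/\ d \in Sym grid,
  forall i x, d (pos i x) = pos i (tperm k l x) &
  rho d * triple_shuffle (enum 'I_m) = triple_shuffle (enum 'I_m)].
Proof.
suff gen s : uniq s -> exists d : 'S_n, [/\ d \in Sym grid,
    forall i x, d (pos i x) = if i \in s then pos i (tperm k l x) else pos i x &
    rho d * triple_shuffle (enum 'I_m) = triple_shuffle (enum 'I_m)].
  have [d [dS dE dT]] := gen _ (enum_uniq 'I_m).
  by exists d; split=> // i x; rewrite dE mem_enum.
elim: s => [_ | j s IH /=].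
  by exists 1%g; split=> [|i x|]; rewrite ?group1 ?perm1 ?gelt1 ?mul1r.
case/andP=> js us; have [d [dS dE dT]] := IH us.
have tj : tperm (pos j k) (pos j l) \in Sym (triple j).
  by apply: tperm_Sym; rewrite mem_triple.
have tx i x : tperm (pos j k) (pos j l) (pos i x) =
    if i == j then pos j (tperm k l x) else pos i x.
  have [-> | ij] := eqVneq i j; last first.
    by rewrite tpermD //; apply: contraNneq ij => /pos_inj[->].
  case: tpermP => [/pos_inj[_ ->] | /pos_inj[_ ->] | xk xl]; rewrite ?tpermL ?tpermR //.
  by rewrite tpermD //; apply/eqP=> kx; [apply: xk | apply: xl]; rewrite kx.
exists (d * tperm (pos j k) (pos j l))%g; split=> [|i x|].
- by rewrite groupM // (subsetP (SymS (triple_grid j))).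
- rewrite permM dE inE; have [-> | ij] := eqVneq i j.
    by rewrite (negPf js) tx eqxx.
  by case: ifP => _; rewrite tx (negPf ij).
by rewrite geltM -mulrA (triple_absorb _ tj) // mem_enum.
Qed.

Section Realisation.
Variable c : 'I_n.
Hypotheses (c0 : c = 0%N :> nat) (cgrid : c \notin grid).

Lemma savg3 (b b' : 'I_n) : b != c -> b' != c -> b' != b ->
  star_word 3 (savg (c |: [set b; b'])).
Proof.
move=> bc b'c b'b.
have cb : c \in [set c; b] by rewrite !inE eqxx.
have bb : b \in [set c; b] by rewrite !inE eqxx orbT.
have [Z1 Z1w Z1E] := insertion G c0 cb bb.
have cb' : c \in c |: [set b; b'] by rewrite !inE eqxx.
have bb' : b' \in c |: [set b; b'] by rewrite !inE eqxx !orbT.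
have [Z2 Z2w Z2E] := insertion G c0 cb' bb'.
have card2 : #|[set c; b]| = 2%N by rewrite cards2 eq_sym bc.
have D3 : (c |: [set b; b']) :\ b' = [set c; b].
  apply/setP=> x; rewrite !inE; have [-> | _] /= := eqVneq x b'.
    by rewrite (negPf b'c) (negPf b'b).
  by rewrite orbF.
have card3 : #|c |: [set b; b']| = 3%N by rewrite (cardsD1 b') bb' D3 card2.
rewrite card2 /= in Z1w; rewrite card3 /= in Z2w.
move: Z1E; rewrite [X in X * Z1]savg_small ?mul1r; last first.
  by rewrite cardsD (setIidPr _) ?sub1set // card2 cards1.
move=> Z1E; rewrite D3 -Z1E in Z2E; rewrite -Z2E.
exact: (star_wordM Z1w Z2w).
Qed.

Let c_neq i k : c != pos i k.
Proof. by apply: contraNneq cgrid => ->; apply: mem_grid. Qed.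

Let sig i := tperm c (pos i blk0).

(** The transposition (c a) brings the first point a of the triple to the
    centre, three star transpositions shuffle c with the other two points, and
    a fourth one would bring a point back.  It is left out. *)
Lemma star_word_triple i : star_word 4 (savg (triple i) * rho (sig i)).
Proof.
rewrite savgJ; have -> : sig i @: triple i = c |: [set pos i blk1; pos i blk2].
  apply/setP=> x; rewrite !inE; apply/imsetP/idP => [[_ /imsetP[k _ ->] ->]|].
    have [-> | kk] := eqVneq k blk0; first by rewrite tpermR eqxx.
    have -> : sig i (pos i k) = pos i k.
      by rewrite tpermD //; apply: contraNneq kk => /pos_inj[_ ->].
    by case: k kk => -[|[|[|//]]] Hk // _; rewrite (bool_irrelevance Hk isT) eqxx ?orbT.
  have in_triple k : pos i k \in triple i by rewrite mem_triple.
  case/or3P=> /eqP->.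
  - by exists (pos i blk0); rewrite ?tpermR.
  - exists (pos i blk1) => //; rewrite tpermD //.
    by apply/eqP=> /pos_inj[_ /(congr1 val)].
  - exists (pos i blk2) => //; rewrite tpermD //.
    by apply/eqP=> /pos_inj[_ /(congr1 val)].
apply: (@star_wordM _ _ _ 1 3).
  by apply: star_word_tperm => //; rewrite eq_sym.
apply: savg3 => //; rewrite 1?eq_sym //.
by apply/eqP=> /pos_inj[_ /(congr1 val)].
Qed.

(** Leaving out the returning transpositions only composes the shuffle with a
    fixed permutation, since each of them commutes with the shuffles of the
    other triples.  Such a permutation does no harm to a uniform law. *)
Lemma star_word_triples : exists2 p, p \in Sym (c |: grid) &
  star_word (4 * m) (triple_shuffle (enum 'I_m) * rho p).
Proof.
suff gen s : uniq s -> star_word (4 * size s)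
    (triple_shuffle s * rho (\prod_(i <- s) sig i)%g).
  exists (\prod_(i <- enum 'I_m) sig i)%g.
    apply: group_prod => i _; apply: tperm_Sym; first exact: setU11.
    by apply: setU1r; apply: mem_grid.
  by have := gen _ (enum_uniq 'I_m); rewrite size_enum_ord.
elim: s => [_|i s IH /= /andP[si us]].
  by rewrite /triple_shuffle !big_nil gelt1 mulr1; apply: star_word1.
have := star_wordM (star_word_triple i) (IH us).
rewrite /triple_shuffle !big_cons geltM -mulnS !mulrA; congr (star_word _ (_ * _)).
rewrite -!mulrA; congr (_ * _).
elim: s si {us IH} => [_ | j s IH]; first by rewrite !big_nil mulr1 mul1r.
rewrite inE negb_or big_cons => /andP[ij si]; rewrite mulrA -savg_commute.
  by rewrite -!mulrA IH.
rewrite -[RHS]imset_id; apply: eq_in_imset => _ /imsetP[k _ ->].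
by rewrite tpermD //; apply: contraNneq ij => /pos_inj[->].
Qed.

End Realisation.
End Blocks.

(** * The law after shuffling blocks and triples *)

Section Occupancy.
Variables (R : realType) (n : nat) (G : group_algebra R {perm 'I_n}).
Variables (m : nat) (pos : 'I_m -> 'I_3 -> 'I_n).
Hypothesis pos_inj : forall i k j l, pos i k = pos j l -> i = j /\ k = l.
Implicit Types (S : {set 'I_n}) (i j : 'I_m) (k l : 'I_3) (g d : 'S_n).

Local Notation rho := (gelt G).
Local Notation savg := (savg G).
Local Notation block := (block pos).
Local Notation grid := (grid pos).
Local Notation T := (triple_shuffle G pos (enum 'I_m)).

(** Locked for the same reason as [gavg]. *)
Definition block_shuffle :=
  locked (savg (block blk0) * savg (block blk1) * savg (block blk2) * T).

Lemma block_shuffleE :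
  block_shuffle = savg (block blk0) * savg (block blk1) * savg (block blk2) * T.
Proof. by rewrite /block_shuffle -lock. Qed.

Local Notation M := block_shuffle.

Lemma block_absorb k d : d \in Sym (block k) -> rho d * M = M.
Proof.
have dis := block_disjoint pos_inj.
have d01 : [disjoint block blk0 & block blk1] by apply: dis.
have d02 : [disjoint block blk0 & block blk2] by apply: dis.
have d12 : [disjoint block blk1 & block blk2] by apply: dis.
have kP : [|| k == blk0, k == blk1 | k == blk2] by case: (k) => -[|[|[|]]].
case/or3P: kP => /eqP-> db; have bd := savgMl G db; rewrite block_shuffleE.
- by rewrite !mulrA bd.
- by rewrite (savgC G d01) !mulrA bd.
- by rewrite -(mulrA (savg (block blk0))) (savgC G d12) mulrA (savgC G d02) !mulrA bd.
Qed.

(** Permuting whole blocks before [block_shuffle] changes nothing: the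
    permutation passes through the block averages, which it exchanges, and is
    absorbed by the triples. *)
Lemma swap_absorb k l : (k, l) \in [:: (blk0, blk1); (blk1, blk2)] ->
  exists d, [/\ d \in Sym grid,
    forall i x, d (pos i x) = pos i (tperm k l x) & rho d * M = M].
Proof.
move=> kl; have [d [dS dE dT]] := swap_blocks G pos_inj k l.
exists d; split=> //; pose b x := savg (block x).
have bC x y : b x * b y = b y * b x.
  by have [-> //|xy] := eqVneq x y; apply/savgC/block_disjoint.
have bd x : rho d * b x = b (tperm k l x) * rho d.
  by rewrite /b savgJ (swap_image _ dE) tpermK.
rewrite block_shuffleE -/(b blk0) -/(b blk1) -/(b blk2).
rewrite !mulrA bd -[_ * rho d * b _]mulrA bd !mulrA -[_ * rho d * b _]mulrA bd !mulrA.
rewrite -mulrA dT; congr (_ * _).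
move: kl; rewrite !inE => /orP[]/eqP[-> ->].
  by rewrite tpermL tpermR tpermD // (bC blk1).
by rewrite tpermL tpermR tpermD // -!mulrA (bC blk1).
Qed.

Lemma grid_absorb_r : savg grid * M = savg grid.
Proof.
rewrite block_shuffleE !mulrA !savg_absr ?block_grid //.
elim: (enum 'I_m) => [|i s IH]; first by rewrite /triple_shuffle big_nil mulr1.
by rewrite /triple_shuffle big_cons mulrA savg_absr ?triple_grid.
Qed.

Section Slots.
Variable X : {set 'I_n}.
Hypothesis sX : X \subset grid.

(** The law of a uniform permutation that preserves X; it forgets which counter
    starts where. *)
Definition start_mix := locked (savg (grid :\: X) * savg X).

Lemma start_mixE : start_mix = savg (grid :\: X) * savg X.
Proof. by rewrite /start_mix -lock. Qed.

Local Notation P := start_mix.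

(** A permutation of the grid that preserves X is a permutation of X times a
    permutation of the complement. *)
Lemma start_absorb g : g \in Sym grid -> g @: X = X -> P * rho g = P.
Proof.
move=> gS gX; pose fX := restr_perm X g.
have gN : g \in 'N(X | 'P)%g.
  by apply/astabsP=> x; rewrite /= apermE -{1}gX mem_imset //; apply: perm_inj.
have fS : fX \in Sym X by apply/SymP=> x xX; apply/(out_perm (restr_perm_on _ _)).
pose h := (fX^-1 * g)%g.
have hS : h \in Sym (grid :\: X).
  apply/SymP=> x; rewrite inE negb_and negbK permM => /orP[xX | xG].
    have := restr_permE gN; rewrite -/fX => fE.
    have yX : (fX^-1 x)%g \in X.
      by rewrite -(Sym_stable (groupVr fS)) imset_f.
    by rewrite -fE // permKV.
  have xX : x \notin X by apply: contra xG; apply: (subsetP sX).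
  by rewrite (SymP _ _ (groupVr fS)) // (SymP _ _ gS).
have dD : [disjoint X & grid :\: X].
  by rewrite disjoint_sym disjoints_subset subDset setUCr subsetT.
have -> : g = (fX * h)%g by rewrite mulKVg.
rewrite geltM start_mixE mulrA -(mulrA _ _ (rho fX)) savgMr // -mulrA.
by rewrite savg_commute ?(disjoint_stable dD hS) // mulrA savgMr.
Qed.

Lemma start_absorb_grid : P * savg grid = savg grid.
Proof. by rewrite start_mixE -mulrA !savg_absl ?subsetDl. Qed.

(** The law after the counters have been moved from X to g @: X. *)
Definition outcome g := P * rho g * M.

Lemma outcome_move g g' d : g \in Sym grid -> g' \in Sym grid -> d \in Sym grid ->
  rho d * M = M -> d @: (g @: X) = g' @: X -> outcome g = outcome g'.
Proof.
move=> gS g'S dS dM dX; rewrite /outcome -[in LHS]dM !mulrA -(mulrA P) -geltM.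
have -> : (g * d = (g * d * g'^-1) * g')%g by rewrite mulgKV.
rewrite geltM mulrA start_absorb ?groupM ?groupV //.
by rewrite !imset_permM dX -imset_permM mulgV imset_perm1.
Qed.

Definition occ k S := #|S :&: block k|.

Lemma occ_image g d k l : d @: block k = block l ->
  occ l ((g * d)%g @: X) = occ k (g @: X).
Proof.
move=> dk; rewrite /occ imset_permM -dk -imsetI; last by apply: in2W; apply: perm_inj.
by rewrite card_imset //; apply: perm_inj.
Qed.

(** Two sets with the same occupancies differ by permutations inside the blocks,
    which [block_shuffle] absorbs. *)
Lemma outcome_occ g g' : g \in Sym grid -> g' \in Sym grid ->
  (forall k, occ k (g @: X) = occ k (g' @: X)) -> outcome g = outcome g'.
Proof.
move=> gS g'S eq_occ; set S := g @: X; set S' := g' @: X.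
have move_in k : exists2 d, d \in Sym (block k) & d @: (S :&: block k) = S' :&: block k.
  by apply: Sym_move; rewrite ?subsetIr //; apply: eq_occ.
have [d0 d0S d0E] := move_in blk0.
have [d1 d1S d1E] := move_in blk1.
have [d2 d2S d2E] := move_in blk2.
have sG k d : d \in Sym (block k) -> d \in Sym grid.
  by apply/subsetP/SymS/block_grid.
have inblk x : x \in grid -> [|| x \in block blk0, x \in block blk1 | x \in block blk2].
  case/gridP=> i [k ->]; rewrite !(mem_pos pos_inj).
  by case: (k) => -[|[|[|]]].
have fixd k l d x : k != l -> d \in Sym (block k) -> x \in block l -> d x = x.
  move=> kl dS xl; apply: (SymP _ _ dS); apply/negP=> xk.
  by have /pred0P/(_ x) := block_disjoint pos_inj kl; rewrite /= xk xl.
have inS' k d x : d \in Sym (block k) -> d @: (S :&: block k) = S' :&: block k ->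
    x \in S -> x \in block k -> d x \in S' /\ d x \in block k.
  move=> _ dE xS xk; apply/andP; rewrite -in_setI -dE imset_f // inE xS xk //.
have sSg : S \subset grid by rewrite -(Sym_stable gS) imsetS.
apply: (@outcome_move _ _ (d0 * d1 * d2)%g) => //.
- by rewrite (groupM (groupM (sG _ _ d0S) (sG _ _ d1S)) (sG _ _ d2S)).
- by rewrite !geltM -!mulrA (block_absorb d2S) (block_absorb d1S) (block_absorb d0S).
apply/eqP; rewrite eqEcard; apply/andP; split; last first.
  by rewrite !card_imset //; apply: perm_inj.
apply/subsetP=> _ /imsetP[x xS ->]; rewrite !permM.
case/or3P: (inblk x (subsetP sSg x xS)) => xk.
- have [y1 y2] := inS' _ _ _ d0S d0E xS xk.
  by rewrite (fixd blk1 blk0 d1) // (fixd blk2 blk0 d2).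
- have [y1 y2] := inS' _ _ _ d1S d1E xS xk.
  by rewrite (fixd blk0 blk1 d0) // (fixd blk2 blk1 d2).
- have [y1 y2] := inS' _ _ _ d2S d2E xS xk.
  by rewrite (fixd blk0 blk2 d0) // (fixd blk1 blk2 d1).
Qed.

(** The common value of outcome on the g with occupancies a, b, c.  The default
    value 0 keeps it symmetric in a, b, c even for occupancies that do not
    occur. *)
Definition outcome_of (a b c : nat) : G :=
  if [pick g in Sym grid |
      [&& occ blk0 (g @: X) == a, occ blk1 (g @: X) == b & occ blk2 (g @: X) == c]]
  is Some g then outcome g else 0.

Lemma outcome_ofE g : g \in Sym grid ->
  outcome g = outcome_of (occ blk0 (g @: X)) (occ blk1 (g @: X)) (occ blk2 (g @: X)).
Proof.
move=> gS; rewrite /outcome_of; case: pickP => [g' | /(_ g)]; last first.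
  by rewrite gS !eqxx.
case/and4P=> g'S /eqP e0 /eqP e1 /eqP e2; apply: outcome_occ => // k.
have: [|| k == blk0, k == blk1 | k == blk2] by case: (k) => -[|[|[|]]].
by case/or3P=> /eqP->.
Qed.

Lemma outcome_swap k l g : (k, l) \in [:: (blk0, blk1); (blk1, blk2)] -> g \in Sym grid ->
  exists2 g', g' \in Sym grid & outcome g' = outcome g /\
  forall k', occ (tperm k l k') (g' @: X) = occ k' (g @: X).
Proof.
move=> /swap_absorb[d [dS dE dM]] gS; exists (g * d)%g; first exact: groupM.
split=> [|k']; last by apply: occ_image; apply: swap_image.
by rewrite /outcome geltM -!mulrA dM.
Qed.

Lemma outcome_of01 a b c : outcome_of a b c = outcome_of b a c.
Proof.
suff half a' b' g : g \in Sym grid -> occ blk0 (g @: X) = a' -> occ blk1 (g @: X) = b' ->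
    occ blk2 (g @: X) = c -> outcome_of b' a' c = outcome g.
  rewrite {1}/outcome_of; case: pickP => [g|no].
    by case/and4P=> gS /eqP e0 /eqP e1 /eqP e2; rewrite (half a b g).
  rewrite /outcome_of; case: pickP => // g /and4P[gS /eqP e0 /eqP e1 /eqP e2].
  have [g' g'S [_ occ']] := @outcome_swap blk0 blk1 g (mem_head _ _) gS.
  have := no g'; rewrite g'S.
  by move: (occ' blk0) (occ' blk1) (occ' blk2); rewrite tpermL tpermR tpermD // e0 e1 e2
    => -> -> ->; rewrite !eqxx.
move=> gS <- <- <-; have [g' g'S [<- occ']] := @outcome_swap blk0 blk1 g (mem_head _ _) gS.
rewrite (outcome_ofE g'S).
by rewrite -(occ' blk0) -(occ' blk1) -(occ' blk2) tpermL tpermR tpermD.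
Qed.

Lemma outcome_of12 a b c : outcome_of a b c = outcome_of a c b.
Proof.
have kl : (blk1, blk2) \in [:: (blk0, blk1); (blk1, blk2)] by rewrite !inE eqxx orbT.
suff half b' c' g : g \in Sym grid -> occ blk0 (g @: X) = a -> occ blk1 (g @: X) = b' ->
    occ blk2 (g @: X) = c' -> outcome_of a c' b' = outcome g.
  rewrite {1}/outcome_of; case: pickP => [g|no].
    by case/and4P=> gS /eqP e0 /eqP e1 /eqP e2; rewrite (half b c g).
  rewrite /outcome_of; case: pickP => // g /and4P[gS /eqP e0 /eqP e1 /eqP e2].
  have [g' g'S [_ occ']] := @outcome_swap blk1 blk2 g kl gS.
  have := no g'; rewrite g'S.
  by move: (occ' blk0) (occ' blk1) (occ' blk2); rewrite tpermL tpermR tpermD // e0 e1 e2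
    => -> -> ->; rewrite !eqxx.
move=> gS <- <- <-; have [g' g'S [<- occ']] := @outcome_swap blk1 blk2 g kl gS.
rewrite (outcome_ofE g'S).
by rewrite -(occ' blk0) -(occ' blk1) -(occ' blk2) tpermL tpermR tpermD.
Qed.

Lemma savg_grid_outcome : savg grid = #|Sym grid|%:R^-1 *:
  \sum_(g in Sym grid)
     outcome_of (occ blk0 (g @: X)) (occ blk1 (g @: X)) (occ blk2 (g @: X)).
Proof.
rewrite -[LHS]start_absorb_grid -[in LHS]grid_absorb_r.
rewrite [X in _ * (X * _)]gavgE.
rewrite -scalerAl -scalerAr mulr_suml mulr_sumr; congr (_ *: _).
by apply: eq_bigr => g gS; rewrite mulrA -outcome_ofE.
Qed.

End Slots.
End Occupancy.

(** * Counting occupancies *)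

Section Counting.
Variables (T : finType) (V : zmodType).
Implicit Types (A B S : {set T}).

Lemma sum_subsets_setU A B (F : {set T} -> {set T} -> V) : [disjoint A & B] ->
  \sum_(S : {set T} | S \subset A :|: B) F (S :&: A) (S :&: B) =
  \sum_(S1 : {set T} | S1 \subset A) \sum_(S2 : {set T} | S2 \subset B) F S1 S2.
Proof.
move=> dAB; have AB0 : A :&: B = set0 by apply/eqP; rewrite setI_eq0.
have restr (S1 S2 : {set T}) : S1 \subset A -> S2 \subset B ->
    ((S1 :|: S2) :&: A = S1) * ((S1 :|: S2) :&: B = S2).
  move=> s1 s2; rewrite !setIUl (setIidPl s1) (setIidPl s2).
  have -> : S2 :&: A = set0.
    by apply/eqP; rewrite -subset0 -AB0 setIC setIS.
  have -> : S1 :&: B = set0 by apply/eqP; rewrite -subset0 -AB0 setSI.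
  by rewrite setU0 set0U.
rewrite pair_big_dep /=.
rewrite (reindex_onto (fun p : {set T} * {set T} => p.1 :|: p.2)
                      (fun S => (S :&: A, S :&: B))) /=; last first.
  by move=> S sS; rewrite -setIUr; apply/setIidPl.
apply: eq_big => [[S1 S2] | [S1 S2]] /=.
  apply/andP/andP=> [[_ /eqP[<- <-]] | [s1 s2]]; first by rewrite !subsetIr.
  by rewrite setUSS // !(restr _ _ s1 s2).
by case/andP=> _ /eqP[-> ->].
Qed.

Lemma sum_subsets_card A b (f : nat -> V) :
  (forall a, (b <= a)%N -> f a = 0) ->
  \sum_(S : {set T} | S \subset A) f #|S| = \sum_(a < b) f a *+ 'C(#|A|, a).
Proof.
move=> f0; transitivity (\sum_(S : {set T} | (S \subset A) && (#|S| < b)%N) f #|S|).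
  rewrite big_mkcondr; apply: eq_bigr => S _.
  by case: ltnP => // /f0.
case: b f0 => [f0|b f0]; first by rewrite big_ord0 big1 // => S; rewrite ltn0 andbF.
rewrite (partition_big (fun S : {set T} => inord #|S| : 'I_b.+1) xpredT) //=.
apply: eq_bigr => a _; rewrite -cards_draws -sumr_const; apply: eq_big => [S|S].
  rewrite inE -andbA; congr (_ && _); apply/andP/eqP => [[lt_S /eqP<-]|->].
    by rewrite inordK.
  by rewrite ltn_ord inord_val.
by case/andP=> /andP[_ lt_S] /eqP<-; rewrite inordK.
Qed.

End Counting.

Section AverageSets.
Variables (R : realFieldType) (n : nat) (V : lmodType R) (N X : {set 'I_n}).
Hypothesis sXN : X \subset N.

(** The permutations of N that send X onto a given set form a coset, so all
    subsets of N of the size of X are reached equally often. *)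
Lemma average_images (h : {set 'I_n} -> V) :
  #|Sym N|%:R^-1 *: \sum_(g in Sym N) h (g @: X) =
  'C(#|N|, #|X|)%:R^-1 *: \sum_(S : {set 'I_n} | (S \subset N) && (#|S| == #|X|)) h S.
Proof.
pose c := #|[set g in Sym N | g @: X == X]|.
have inF (S : {set 'I_n}) g :
    (g \in [set g in Sym N | g @: X == S]) = (g \in Sym N) && (g @: X == S).
  by rewrite inE.
have fibre (S : {set 'I_n}) : (S \subset N) && (#|S| == #|X|) ->
    #|[set g in Sym N | g @: X == S]| = c.
  case/andP=> sS /eqP eS; have [d dN dX] := Sym_move sXN sS (esym eS).
  rewrite /c -[RHS](card_imset _ (mulIg d)); apply: eq_card => g; rewrite inF.
  apply/andP/imsetP => [[gN /eqP gX] | [f]].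
    exists (g * d^-1)%g; last by rewrite mulgKV.
    rewrite inF groupM ?groupV //=.
    by rewrite imset_permM gX -dX -imset_permM mulgV imset_perm1.
  rewrite inF => /andP[fN /eqP fX] ->; rewrite imset_permM fX dX; split=> //.
  by rewrite groupM.
have memP g : g \in Sym N -> (g @: X \subset N) && (#|g @: X| == #|X|).
  move=> gN; rewrite -{1}(Sym_stable gN) imsetS //= card_imset //; exact: perm_inj.
have sumE (W : zmodType) (k : {set 'I_n} -> W) : \sum_(g in Sym N) k (g @: X) =
    (\sum_(S : {set 'I_n} | (S \subset N) && (#|S| == #|X|)) k S) *+ c.
  rewrite (partition_big (fun g : 'S_n => g @: X)
    (fun S : {set 'I_n} => (S \subset N) && (#|S| == #|X|))) //= -sumrMnl; apply: eq_bigr => S PS.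
  rewrite -(fibre S PS) -sumr_const; apply: eq_big => g; first by rewrite inF.
  by case/andP=> _ /eqP ->.
have cardE : #|Sym N|%:R = ('C(#|N|, #|X|) * c)%:R :> R.
  have := sumE R (fun=> 1); rewrite !sumr_const => ->.
  rewrite mulrnA; congr (_ *+ _ *+ _); rewrite -cards_draws.
  by apply: eq_card => S; rewrite inE.
have : #|Sym N|%:R != 0 :> R by apply: (cardG_neq0 R (Sym_group N)).
rewrite sumE -scaler_nat scalerA cardE natrM mulf_eq0 negb_or => /andP[C0 c0].
by rewrite invfM -mulrA mulVf // mulr1.
Qed.
End AverageSets.

Section GridAverage.
Variables (n m : nat) (pos : 'I_m -> 'I_3 -> 'I_n).
Hypothesis pos_inj : forall i k j l, pos i k = pos j l -> i = j /\ k = l.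

Lemma sum_occ (V : zmodType) (f : nat -> nat -> nat -> V) :
  \sum_(S : {set 'I_n} | (S \subset grid pos) && (#|S| == 4%N))
     f (occ pos blk0 S) (occ pos blk1 S) (occ pos blk2 S) =
  \sum_(a < 5) \sum_(b < 5) \sum_(c < 5)
     (if (a + b + c == 4)%N then f a b c else 0)
       *+ 'C(m, c) *+ 'C(m, b) *+ 'C(m, a).
Proof.
have dis := block_disjoint pos_inj.
have d01 : [disjoint block pos blk0 & block pos blk1] by apply: dis.
have d02 : [disjoint block pos blk0 & block pos blk2] by apply: dis.
have d12 : [disjoint block pos blk1 & block pos blk2] by apply: dis.
have d012 : [disjoint block pos blk0 & block pos blk1 :|: block pos blk2].
  by rewrite -setI_eq0 setIUr (disjoint_setI0 d01) (disjoint_setI0 d02) setU0.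
have gridE : grid pos = block pos blk0 :|: (block pos blk1 :|: block pos blk2).
  apply/setP=> x; rewrite !inE; apply/idP/or3P => [/gridP[i [k ->]]|].
    rewrite !(mem_pos pos_inj).
    have: [|| k == blk0, k == blk1 | k == blk2] by case: (k) => -[|[|[|]]].
    by move/or3P.
  by case; apply: (subsetP (block_grid _ _)).
pose F a b c : V := (if (a + b + c == 4)%N then f a b c else 0).
pose H (S1 S' : {set 'I_n}) := F #|S1| #|S' :&: block pos blk1| #|S' :&: block pos blk2|.
transitivity (\sum_(S : {set 'I_n} |
    S \subset block pos blk0 :|: (block pos blk1 :|: block pos blk2))
    H (S :&: block pos blk0) (S :&: (block pos blk1 :|: block pos blk2))).
  rewrite big_mkcondr gridE; apply: eq_bigr => S sS; rewrite /H /F -!setIA.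
  have -> : (block pos blk1 :|: block pos blk2) :&: block pos blk1 = block pos blk1.
    by rewrite setUK.
  have -> : (block pos blk1 :|: block pos blk2) :&: block pos blk2 = block pos blk2.
    by rewrite setUC setUK.
  have cardU (A B : {set 'I_n}) : [disjoint A & B] ->
      #|S :&: (A :|: B)| = (#|S :&: A| + #|S :&: B|)%N :> nat.
    move=> dAB; have sAB : S :&: A :&: (S :&: B) = set0.
      by apply/eqP; rewrite -subset0 -(disjoint_setI0 dAB) setISS ?subsetIr.
    by rewrite setIUr cardsU sAB cards0 subn0.
  have -> : #|S| = (#|S :&: block pos blk0| + #|S :&: block pos blk1| + #|S :&: block pos blk2|)%N.
    rewrite -{1}(setIidPl sS) cardU ?cardU ?addnA //.
  by [].
rewrite (sum_subsets_setU _ d012).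
pose H1 a := \sum_(b < 5) \sum_(c < 5) F a b c *+ 'C(m, c) *+ 'C(m, b).
transitivity (\sum_(S1 : {set 'I_n} | S1 \subset block pos blk0) H1 #|S1|).
  apply: eq_bigr => S1 _.
  pose K (S1' S2' : {set 'I_n}) := F #|S1| #|S1'| #|S2'|.
  rewrite (sum_subsets_setU K d12).
  rewrite (eq_bigr (fun S2 : {set 'I_n} => \sum_(c < 5) F #|S1| #|S2| c *+ 'C(m, c))).
    rewrite (@sum_subsets_card _ _ _ 5 (fun b => \sum_(c < 5) F #|S1| b c *+ 'C(m, c))).
      by rewrite (card_block pos_inj); under eq_bigr do rewrite -sumrMnl.
    move=> b b5; apply: big1 => c _; rewrite /F; case: eqP => [|_]; rewrite ?mul0rn //; lia.
  move=> S2 _; rewrite (@sum_subsets_card _ _ _ 5 (F #|S1| #|S2|)) ?(card_block pos_inj) //.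
  by move=> c c5; rewrite /F; case: eqP => // ; lia.
rewrite (@sum_subsets_card _ _ _ 5 H1) ?(card_block pos_inj).
  apply: eq_bigr => a _; rewrite -sumrMnl; apply: eq_bigr => b _.
  by rewrite -sumrMnl.
move=> a a5; apply: big1 => b _; apply: big1 => c _; rewrite /F.
case: eqP => [|_]; rewrite ?mul0rn //; lia.
Qed.

End GridAverage.

(** * Moving counters between slots *)

Section Slots.
Variables (R : realType) (n : nat) (G : group_algebra R {perm 'I_n}).
Variables (m : nat) (pos : 'I_m.+4 -> 'I_3 -> 'I_n).
Hypothesis pos_inj : forall i k j l, pos i k = pos j l -> i = j /\ k = l.

Local Notation rho := (gelt G).
Local Notation savg := (savg G).
Local Notation block := (block pos).
Local Notation grid := (grid pos).
Implicit Type o : seq bool.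

(** Counters wait in slots until their block is spread; a block has as many
    slots as its rank in the sorted occupancies can require. *)
Definition slot_block (j : nat) : 'I_3 := nth blk0 [:: blk0; blk0; blk0; blk0; blk1; blk1; blk2] j.
Definition slot_row (j : nat) : nat := nth 0%N [:: 0; 1; 2; 3; 0; 1; 0]%N j.
Definition slot j := pos (inord (slot_row j)) (slot_block j).

Lemma slot_inj (i j : 'I_7) : slot i = slot j -> i = j.
Proof.
case/pos_inj=> /(congr1 val) /=; rewrite !inordK.
- move=> eq_row eq_block; apply: val_inj.
  by move: i j eq_row eq_block => [[|[|[|[|[|[|[|//]]]]]]] ?] [[|[|[|[|[|[|[|//]]]]]]] ?].
- by case: j => [[|[|[|[|[|[|[|//]]]]]]] ?].
- by case: i => [[|[|[|[|[|[|[|//]]]]]]] ?].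
Qed.

Definition occupied o := [set slot (val j) | j in [set j : 'I_7 | nth false o j]].

(** Occupied slots are kept as lists of bits, so that the effect of
    transpositions can be computed. *)
Definition swap_bits a b o :=
  set_nth false (set_nth false o a (nth false o b)) b (nth false o a).

Definition bit_occ k o : nat :=
  count (fun j => nth false o j && (slot_block j == k)) (iota 0 7).

Lemma mem_occupied o (j : 'I_7) : (slot j \in occupied o) = nth false o j.
Proof.
apply/imsetP/idP => [[i] | oj]; last by exists j; rewrite ?inE.
by rewrite inE => oi /slot_inj->.
Qed.

Lemma occ_occupied k o : occ pos k (occupied o) = bit_occ k o.
Proof.
rewrite /occ.
have -> : occupied o :&: block k =
    [set slot (val j) | j in [set j : 'I_7 | nth false o j && (slot_block j == k)]].
  apply/setP=> x; rewrite inE; apply/andP/imsetP => [[/imsetP[j jo ->]] | [j]].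
    by rewrite (mem_pos pos_inj) => jk; exists j => //; move: jo; rewrite !inE => ->.
  by rewrite inE => /andP[oj jk] ->; rewrite mem_occupied (mem_pos pos_inj).
rewrite card_in_imset; last by move=> i j _ _; apply: slot_inj.
rewrite cardsE cardE size_filter -enumT /bit_occ -val_enum_ord count_map.
by apply: eq_count.
Qed.

Lemma swap_occupied_ord (a b : 'I_7) o :
  tperm (slot a) (slot b) @: occupied o = occupied (swap_bits a b o).
Proof.
apply/setP=> x; rewrite -[x](tpermK (slot a) (slot b)) mem_imset; last exact: perm_inj.
set y := tperm _ _ x.
have [/imsetP[j _ ->] | nslot] := boolP (y \in [set slot (val j) | j in [set: 'I_7]]).
  rewrite mem_occupied.
  have -> : tperm (slot a) (slot b) (slot j) = slot (tperm a b j).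
    case: (tpermP a b j) => [->|->|ja jb]; rewrite ?tpermL ?tpermR //.
    by rewrite tpermD //; apply/eqP=> /slot_inj; [move/esym/ja | move/esym/jb].
  rewrite mem_occupied /swap_bits !nth_set_nth /=.
  rewrite !(inj_eq val_inj); case: (tpermP a b j) => [->|->|/eqP ja /eqP jb].
  - by rewrite eqxx.
  - by rewrite nth_set_nth /= eqxx; case: eqVneq => [e|_]; rewrite ?e.
  - by rewrite (negPf jb) nth_set_nth /= (inj_eq val_inj) (negPf ja).
have yx : x = y.
  rewrite /y; case: tpermP => // xE; case/imsetP: nslot; rewrite /y xE ?tpermL ?tpermR.
    by exists b.
  by exists a.
have -> : tperm (slot a) (slot b) y = y by rewrite {1}/y tpermK.
by apply/idP/idP => /imsetP[j _ jE]; case/imsetP: nslot; exists j.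
Qed.

Lemma swap_occupied a b o : (a < 7)%N -> (b < 7)%N ->
  tperm (slot a) (slot b) @: occupied o = occupied (swap_bits a b o).
Proof. by move=> a7 b7; apply: (swap_occupied_ord (Ordinal a7) (Ordinal b7)). Qed.

Lemma occupied_grid o : occupied o \subset grid.
Proof. by apply/subsetP=> _ /imsetP[j _ ->]; apply: mem_grid. Qed.

(** The expected value of f at the final occupancies, when the transpositions of
    w act lazily on the slots. *)
Fixpoint expect (V : lmodType R) (f : nat -> nat -> nat -> V)
    (w : seq (nat * nat * R)) o : V :=
  if w is (a, b, p) :: w' then
    p *: expect f w' (swap_bits a b o) + (1 - p) *: expect f w' o
  else f (bit_occ blk0 o) (bit_occ blk1 o) (bit_occ blk2 o).

Definition mix_word (w : seq (nat * nat * R)) : G :=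
  \prod_(x <- w) lz G (slot x.1.1) (slot x.1.2) x.2.

Lemma outcome_word start w g o : let X := occupied start in
  all (fun x => (x.1.1 < 7) && (x.1.2 < 7))%N w ->
  g \in Sym grid -> g @: X = occupied o ->
  start_mix G pos X * rho g * mix_word w * block_shuffle G pos =
  expect (outcome_of G pos X) w o.
Proof.
move=> X; elim: w g o => [|[[a b] p] w IH] g o /=.
  move=> _ gS gX; rewrite /mix_word big_nil mulr1 -!occ_occupied -gX.
  by rewrite -(outcome_ofE _ pos_inj) //; apply: occupied_grid.
case/andP=> /andP[a7 b7] w7 gS gX; rewrite /mix_word big_cons /=.
rewrite -/(mix_word w) /lz gelt1 mulrA mulrDr -!scalerAr !mulrDl -!scalerAl mulr1.
rewrite (IH g o) // -(mulrA _ (rho g)) -geltM (IH _ (swap_bits a b o)) //.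
  by rewrite groupM // tperm_Sym // mem_grid.
by rewrite imset_permM gX swap_occupied.
Qed.

End Slots.

Section MixingProbabilities.
Variable R : realType.

(** With c = 1/3 the first two equations prescribe the product P and the sum S
    of a and b as rational functions of x; a and b are the roots of
    X^2 - S X + P, whose discriminant is positive and large enough for the
    third equation to have a solution s between 0 and 1.  The right-hand sides
    are the probabilities that a uniform set of four points of the grid with x
    rows has sorted occupancy 4, 31 and 22. *)
Lemma mixing_probabilities (x : R) : 4 <= x ->
  exists a b s : R, [/\ 0 <= a <= 1, 0 <= b <= 1, 0 <= s <= 1 &
   let D := 3 * (3 * x - 1) * (3 * x - 2) in let c := 1 / 3 in
   [/\ a * b * c = (x - 2) * (x - 3) / D,
       a * b * (1 - c) + a * (1 - b) * c + (1 - a) * b * c = 8 * x * (x - 2) / D &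
       (1 - a) * b * (1 - c) * s + (1 - a) * (1 - b) * c * (1 - s) =
         6 * x * (x - 1) / D]].
Proof.
move=> x4; set D := 3 * _ * _.
have D0 : 0 < D by rewrite /D; nra.
pose P := 3 * (x - 2) * (x - 3) / D; pose S := 24 * x * (x - 2) / D.
pose e := Num.sqrt (S ^+ 2 - 4 * P).
have PD : P * D = 3 * (x - 2) * (x - 3) by rewrite /P divfK // gt_eqF.
have SD : S * D = 24 * x * (x - 2) by rewrite /S divfK // gt_eqF.
have P0 : 0 <= P by rewrite /P; apply: divr_ge0; [nra | exact: ltW].
have S0 : 0 <= S by rewrite /S; apply: divr_ge0; [nra | exact: ltW].
have disc : (S ^+ 2 - 4 * P) * D ^+ 2 =
    12 * (x - 2) * (21 * x ^+ 3 + 12 * x ^+ 2 - 87 * x + 18).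
  have -> : (S ^+ 2 - 4 * P) * D ^+ 2 = (S * D) ^+ 2 - 4 * (P * D) * D by ring.
  by rewrite SD PD /D; ring.
have cubic : 36 ^+ 2 <= 12 * (x - 2) * (21 * x ^+ 3 + 12 * x ^+ 2 - 87 * x + 18).
  have x2 : 16 <= x ^+ 2 by rewrite expr2; nra.
  have f1 : 24 <= 12 * (x - 2) by lra.
  have f2 : 54 <= 21 * x ^+ 3 + 12 * x ^+ 2 - 87 * x + 18.
    have -> : 21 * x ^+ 3 + 12 * x ^+ 2 - 87 * x + 18 =
      x * (21 * (x ^+ 2 - 16) + 12 * x + 249) + 18 by ring.
    nra.
  have -> : 36 ^+ 2 = 24 * 54 :> R by ring.
  by apply: ler_pM.
have disc0 : 0 <= S ^+ 2 - 4 * P.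
  by rewrite -(pmulr_lge0 _ (exprn_gt0 2 D0)) disc; apply: le_trans cubic; rewrite exprn_ge0.
have e0 : 0 <= e by apply: sqrtr_ge0.
have e2 : e ^+ 2 = S ^+ 2 - 4 * P by apply: sqr_sqrtr.
have eD : 36 <= e * D.
  have eD0 : 0 <= e * D by rewrite mulr_ge0 // ltW.
  rewrite -(@ler_pXn2r _ 2) ?nnegrE //.
  by rewrite exprMn e2 disc.
have eS : e <= S.
  by rewrite -(@ler_pXn2r _ 2) ?nnegrE // e2; lra.
have S2 : S <= 2 by rewrite /S ler_pdivrMr // /D; nra.
have SP : 0 <= 1 - S + P.
  rewrite -(pmulr_lge0 _ D0).
  have -> : (1 - S + P) * D = D - S * D + P * D by ring.
  by rewrite SD PD /D; nra.
have eS2 : e <= 2 - S.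
  by rewrite -(@ler_pXn2r _ 2) ?nnegrE ?e2 //; [nra | lra].
pose a := (S - e) / 2; pose b := (S + e) / 2.
have abP : a * b = P.
  have -> : a * b = (S ^+ 2 - e ^+ 2) / 4 by rewrite /a /b; field.
  by rewrite e2; field.
have abS : a + b = S by rewrite /a /b; field.
pose c0 := (1 - S + P) / 3; pose b0 := (b - P) * 2 / 3; pose W := 6 * x * (x - 1) / D.
have WD : W * D = 6 * x * (x - 1) by rewrite /W divfK // gt_eqF.
have c0W : c0 < W.
  rewrite -(ltr_pM2r D0) WD.
  have -> : c0 * D = (D - S * D + P * D) / 3 by rewrite /c0; field.
  by rewrite SD PD /D; nra.
have Wb0 : W <= b0.
  rewrite -(ler_pM2r D0) WD.
  have -> : b0 * D = (S * D + e * D - 2 * (P * D)) / 3 by rewrite /b0 /b; field.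
  by rewrite SD PD; nra.
have bc : b0 - c0 != 0 by rewrite subr_eq0 gt_eqF // (lt_le_trans c0W).
exists a, b, ((W - c0) / (b0 - c0)); split.
- by rewrite /a; apply/andP; split; lra.
- by rewrite /b; apply/andP; split; lra.
- rewrite divr_ge0 ?ler_pdivrMr ?subr_gt0 ?subr_ge0 ?mul1r ?(lt_le_trans c0W) //=.
  + by rewrite lerD2r.
  + exact: ltW.
  + exact: le_trans (ltW c0W) Wb0.
move=> D' c; have -> : D' = D by [].
have {D'} Dn0 : D != 0 by rewrite gt_eqF.
rewrite -/W; clearbody D; split.
- by rewrite abP /P /c; field.
- have -> : a * b * (1 - c) + a * (1 - b) * c + (1 - a) * b * c = (a + b) / 3.
    by rewrite /c; field.
  by rewrite abS /S; field.
have -> : (1 - a) * b * (1 - c) = b0 by rewrite /b0 -abP /c; field.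
have -> : (1 - a) * (1 - b) * c = c0 by rewrite /c0 -abP -abS /c; field.
by field.
Qed.
End MixingProbabilities.

Section Types.
Variables (R : realType) (V : lmodType R) (f : nat -> nat -> nat -> V).
Hypotheses (f01 : forall a b c, f a b c = f b a c)
           (f12 : forall a b c, f a b c = f a c b).

(** Every value of a symmetric f at the occupancies of four counters is one of
    these four. *)
Definition by_type (u4 u31 u22 u211 : R) : V :=
  u4 *: f 4 0 0 + u31 *: f 3 1 0 + u22 *: f 2 2 0 + u211 *: f 2 1 1.

Lemma by_typeD a b c d a' b' c' d' :
  by_type a b c d + by_type a' b' c' d' = by_type (a + a') (b + b') (c + c') (d + d').
Proof. by rewrite /by_type !scalerDl !addrA (ACl (1*5*2*6*3*7*4*8)). Qed.

Lemma by_typeZ p a b c d : p *: by_type a b c d = by_type (p * a) (p * b) (p * c) (p * d).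
Proof. by rewrite /by_type !scalerDr !scalerA. Qed.

Lemma typesE :
  ((f 4 0 0 = by_type 1 0 0 0) * (f 0 4 0 = by_type 1 0 0 0) *
   (f 0 0 4 = by_type 1 0 0 0)) *
  ((f 3 1 0 = by_type 0 1 0 0) * (f 3 0 1 = by_type 0 1 0 0) *
   (f 1 3 0 = by_type 0 1 0 0) * (f 0 3 1 = by_type 0 1 0 0) *
   (f 1 0 3 = by_type 0 1 0 0) * (f 0 1 3 = by_type 0 1 0 0)) *
  ((f 2 2 0 = by_type 0 0 1 0) * (f 2 0 2 = by_type 0 0 1 0) *
   (f 0 2 2 = by_type 0 0 1 0)) *
  ((f 2 1 1 = by_type 0 0 0 1) * (f 1 2 1 = by_type 0 0 0 1) *
   (f 1 1 2 = by_type 0 0 0 1)).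
Proof.
do !split; rewrite /by_type !scale0r !(addr0, add0r) scale1r //.
- by rewrite f01.
- by rewrite f01 f12.
- by rewrite f12 f01.
- by rewrite f12 f01 f12.
- by rewrite f01 f12.
- by rewrite f12 f01.
Qed.

Lemma by_typeMn k a b c d :
  by_type a b c d *+ k = by_type (a * k%:R) (b * k%:R) (c * k%:R) (d * k%:R).
Proof. by rewrite -scaler_nat by_typeZ !(mulrC k%:R). Qed.

(** Starting from slots 0 to 3, three counters leave block 0 independently: they
    stay with probability a, b and 1/3.  These choices fix how many counters
    leave.  The last transposition moves weight between 22 and 211 without
    touching the occupancies 4 and 31. *)
Definition mixer (a b s : R) : seq (nat * nat * R) :=
  [:: (1%N, 4%N, 1 - a); (2%N, 5%N, 1 - b); (3%N, 6%N, 1 - 1 / 3); (5%N, 6%N, s)].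
Definition start := [:: true; true; true; true; false; false; false].

Lemma expect_mixer a b s : let c := 1 / 3 in
  expect f (mixer a b s) start = by_type (a * b * c)
    (a * b * (1 - c) + a * (1 - b) * c + (1 - a) * b * c)
    ((1 - a) * b * (1 - c) * s + (1 - a) * (1 - b) * c * (1 - s))
    (a * (1 - b) * (1 - c) + (1 - a) * b * (1 - c) * (1 - s)
     + (1 - a) * (1 - b) * c * s + (1 - a) * (1 - b) * (1 - c)).
Proof.
rewrite /expect /mixer /start /bit_occ /=.
rewrite !(add0n, addn0, add1n) !typesE !(by_typeZ, by_typeD).
by congr (by_type _ _ _ _); field.
Qed.

Variable m : nat.

Lemma sum_types :
  \sum_(a < 5) \sum_(b < 5) \sum_(c < 5)
     (if (a + b + c == 4)%N then f a b c else 0)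
       *+ 'C(m, c) *+ 'C(m, b) *+ 'C(m, a) =
  by_type (3 * 'C(m, 4)%:R) (6 * 'C(m, 3)%:R * m%:R) (3 * 'C(m, 2)%:R ^+ 2)
    (3 * 'C(m, 2)%:R * m%:R ^+ 2).
Proof.
rewrite !big_ord_recl !big_ord0 /= !(mul0rn, add0r, addr0).
rewrite /bump /= !(add0n, add1n) !typesE !(by_typeMn, by_typeD) !bin0 !bin1.
by congr (by_type _ _ _ _); ring.
Qed.

End Types.

Section Binomials.
Variable R : realFieldType.

Lemma binSR m k : (k <= m)%N ->
  'C(m, k.+1)%:R = 'C(m, k)%:R * (m%:R - k%:R) / k.+1%:R :> R.
Proof.
move=> km; have := mul_bin_left m k => /(congr1 (fun j => j%:R : R)).
rewrite !natrM natrB // [_ * 'C(m, k)%:R]mulrC => <-.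
by rewrite [k.+1%:R * _]mulrC mulfK // pnatr_eq0.
Qed.

Lemma bin4R m : (4 <= m)%N ->
  'C(m, 4)%:R = m%:R * (m%:R - 1) * (m%:R - 2) * (m%:R - 3) / 24 :> R.
Proof.
by move=> m4; rewrite !binSR ?bin0 ?subr0; try lia; field.
Qed.

Lemma bin3R m : (4 <= m)%N ->
  'C(m, 3)%:R = m%:R * (m%:R - 1) * (m%:R - 2) / 6 :> R.
Proof.
by move=> m4; rewrite !binSR ?bin0 ?subr0; try lia; field.
Qed.
End Binomials.

(** * Four counters on a grid *)

Lemma shuffle_three_blocks (A : pzRingType) (E0 E1 E2 Z1 Z2 Z3 S0 S1 S2 : A) :
  E0 * E1 = E1 * E0 -> E0 * E2 = E2 * E0 -> E1 * E2 = E2 * E1 ->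
  E1 * S0 = S0 * E1 -> E2 * S0 = S0 * E2 -> E2 * S1 = S1 * E2 ->
  E0 * Z1 = S0 -> E1 * Z2 = S1 -> E2 * Z3 = S2 ->
  E0 * E1 * E2 * Z1 * Z2 * Z3 = S0 * S1 * S2.
Proof.
move=> c01 c02 c12 c10 c20 c21 z1 z2 z3.
rewrite c01 -(mulrA E1) c02 !mulrA -(mulrA (E1 * E2)) z1 -(mulrA E1) c20 mulrA c10.
rewrite -(mulrA S0 E1) c12 mulrA -(mulrA (S0 * E2)) z2 -(mulrA S0 E2) c21 mulrA.
by rewrite -(mulrA (S0 * S1)) z3.
Qed.

Section Core.
Variables (R : realType) (n : nat) (G : group_algebra R {perm 'I_n}).
Variables (m : nat) (pos : 'I_m.+4 -> 'I_3 -> 'I_n).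
Hypothesis pos_inj : forall i k j l, pos i k = pos j l -> i = j /\ k = l.
Let X := occupied pos start.
Let sX : X \subset grid pos := occupied_grid pos start.

Lemma card_start : #|X| = 4%N.
Proof.
rewrite card_in_imset; last by move=> i j _ _; apply: slot_inj.
rewrite cardsE cardE size_filter -enumT.
rewrite -(count_map (val : 'I_7 -> nat) (fun j => nth false start j)).
by rewrite val_enum_ord.
Qed.

(** Both sides are combinations of the same four outcomes: the left one with the
    weights produced by the mixer, the right one with the proportions of the
    sets of four points that have the given sorted occupancy. *)
Lemma grid_mixture : exists a b s : R, [/\ 0 <= a <= 1, 0 <= b <= 1, 0 <= s <= 1 &
  start_mix G pos X * mix_word G pos (mixer a b s) * block_shuffle G pos =
  savg G (grid pos)].
Proof.
pose x : R := m.+4%:R.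
have x4 : 4 <= x by rewrite ler_nat.
have [a [b [s [a01 b01 s01 [e4 e31 e22]]]]] := mixing_probabilities x4.
exists a, b, s; split=> //.
have f01 := outcome_of01 G pos_inj sX.
have f12 := outcome_of12 G pos_inj sX.
have gX : (1%g : 'S_n) @: X = occupied pos start by rewrite imset_perm1.
have := outcome_word G pos_inj (w := mixer a b s) isT (group1 _) gX.
rewrite gelt1 mulr1 => ->; rewrite (expect_mixer f01 f12).
rewrite [RHS](savg_grid_outcome G pos_inj sX).
pose f := outcome_of G pos X.
rewrite (average_images sX (fun S => f (occ pos blk0 S) (occ pos blk1 S) (occ pos blk2 S))).
rewrite card_start (sum_occ pos_inj f) (sum_types f01 f12) by_typeZ.
rewrite (card_grid pos_inj) e4 e31 e22.
(* The weight of 211 is what is left of the total mass. *)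
set u := (X in by_type _ _ _ _ X).
have -> : u = 1 - (x - 2) * (x - 3) / (3 * (3 * x - 1) * (3 * x - 2))
    - 8 * x * (x - 2) / (3 * (3 * x - 1) * (3 * x - 2))
    - 6 * x * (x - 1) / (3 * (3 * x - 1) * (3 * x - 2)).
  by rewrite -e4 -e31 -e22 /u; ring.
rewrite !bin4R ?bin3R ?binSR ?bin0 ?subr0 //; try lia.
rewrite natrM -/x /f.
have n0 : [/\ x != 0, 3 * x - 1 != 0, 3 * x - 2 != 0 & 3 * x - 3 != 0].
  by split; apply: lt0r_neq0; lra.
have xE : x = 4 + m%:R by rewrite /x -addn4 natrD addrC.
case: n0 => n0 n1 n2 n3.
by congr (by_type _ _ _ _ _); field; rewrite -xE n0 n1 n2 n3.
Qed.

Variable c : 'I_n.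
Hypotheses (c0 : c = 0%N :> nat) (cgrid : c \notin grid pos).

Local Notation savg := (savg G).
Let slots := [set slot pos (val j) | j in [set: 'I_7]].

Let slot_in j : (j < 7)%N -> slot pos j \in slots.
Proof. by move=> j7; apply/imsetP; exists (Ordinal j7). Qed.

Let slot_neq i j : (i < 7)%N -> (j < 7)%N -> i != j -> slot pos i != slot pos j.
Proof.
move=> i7 j7; apply: contraNneq => ij.
by have /(congr1 val)/= -> := slot_inj pos_inj (i := Ordinal i7) (j := Ordinal j7) ij.
Qed.

Lemma mix_word_comm (B : {set 'I_n}) w : [disjoint B & slots] ->
  all (fun x => (x.1.1 < 7) && (x.1.2 < 7))%N w ->
  savg B * mix_word G pos w = mix_word G pos w * savg B.
Proof.
move=> dB; elim: w => [|[[a b] p] w IH] /=.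
  by rewrite /mix_word big_nil mulr1 mul1r.
case/andP=> /andP[a7 b7] /IH IHw; rewrite /mix_word big_cons /= -/(mix_word _ _ w).
rewrite mulrA lz_savgC -?mulrA ?IHw //.
apply: disjointWr dB; apply/subsetP=> z; rewrite !inE => /orP[]/eqP->; exact: slot_in.
Qed.

Lemma star_word_mixer (a b s : R) : 0 <= a <= 1 -> 0 <= b <= 1 -> 0 <= s <= 1 ->
  star_word 12 (mix_word G pos (mixer a b s)).
Proof.
move=> a01 b01 s01; rewrite /mix_word /mixer !big_cons big_nil mulr1 /=.
have comp (p : R) : 0 <= p <= 1 -> 0 <= 1 - p <= 1.
  by move=> /andP[? ?]; apply/andP; split; lra.
have c01 : 0 <= (1 / 3 : R) <= 1 by apply/andP; split; lra.
apply: (@star_wordM _ _ _ 3 9).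
  by apply: (star_word_lz3 G c0); [apply: slot_neq | apply: comp].
apply: (@star_wordM _ _ _ 3 6).
  by apply: (star_word_lz3 G c0); [apply: slot_neq | apply: comp].
apply: (@star_wordM _ _ _ 3 3).
  by apply: (star_word_lz3 G c0); [apply: slot_neq | apply: comp].
by apply: (star_word_lz3 G c0); first apply: slot_neq.
Qed.

(** The word permutes the four counters, moves them between slots, spreads each
    block (four counters in block 0, two in block 1, one in block 2) and
    shuffles the triples up to the fixed permutation p.  The averages over the
    positions that are not slots, needed to spread each block, are contained in
    the average over the complement of X and commute with all that moves only
    slots. *)
Lemma grid_shuffle k : shuffle_cost G 4 m.+4 k ->
  exists2 p, p \in Sym (c |: grid pos) & exists2 Z, star_word (k + 7 * m.+4 + 35) Z &
    savg (grid pos :\: X) * Z = savg (grid pos) * gelt G p.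
Proof.
move=> cost4.
have [a [b [s [a01 b01 s01 mix]]]] := grid_mixture.
have [Z0 Z0w Z0E] := shuffle_cost_insert G c0 (subxx X) card_start (erefl _).
have Z0X : Z0 = savg X by rewrite -Z0E setDv savg_small ?cards0 // mul1r.
pose Y := [set slot pos 4; slot pos 5]; pose W := [set slot pos 6].
have cardY : #|Y| = 2%N by rewrite cards2 slot_neq.
have cardW : #|W| = 1%N by rewrite cards1.
have sX0 : X \subset block pos blk0.
  apply/subsetP=> x /imsetP[j js ->]; move: js; rewrite inE (mem_pos pos_inj).
  by case: j => [[|[|[|[|[|[|[|j]]]]]]] j7].
have sY1 : Y \subset block pos blk1.
  by apply/subsetP=> z; rewrite !inE => /orP[]/eqP->; rewrite (mem_pos pos_inj).
have sW2 : W \subset block pos blk2 by rewrite sub1set (mem_pos pos_inj).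
have cb k' := card_block pos_inj k'.
have [Z1 Z1w Z1E] := cost4 _ _ sX0 card_start (cb blk0).
have [Z2 Z2w Z2E] := shuffle_cost_insert G c0 sY1 cardY (cb blk1).
have [Z3 Z3w Z3E] := shuffle_cost1 G c0 sW2 cardW (cb blk2).
have [p pS Tw] := star_word_triples G pos_inj c0 cgrid.
exists p => //; exists (Z0 * mix_word G pos (mixer a b s) * Z1 * Z2 * Z3 *
  (triple_shuffle G pos (enum 'I_m.+4) * gelt G p)).
  apply: star_word_le (star_wordM (star_wordM (star_wordM (star_wordM (star_wordM
    Z0w (star_word_mixer a01 b01 s01)) Z1w) Z2w) Z3w) Tw).
  by rewrite card_start; clear; lia.
rewrite {Z0w Z0E} Z0X.
pose E0 := savg (block pos blk0 :\: X); pose E1 := savg (block pos blk1 :\: Y).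
pose E2 := savg (block pos blk2 :\: W).
rewrite -/E0 in Z1E; rewrite -/E1 in Z2E; rewrite -/E2 in Z3E.
have dis := block_disjoint pos_inj.
have EC k' l (A B : {set 'I_n}) : A \subset block pos k' -> B \subset block pos l ->
    k' != l -> savg A * savg B = savg B * savg A.
  move=> sA sB kl; apply: savgC; rewrite -setI_eq0 -subset0.
  by rewrite -(disjoint_setI0 (dis _ _ kl)) setISS.
have s0 := subsetDl (block pos blk0) X.
have s1 := subsetDl (block pos blk1) Y.
have s2 := subsetDl (block pos blk2) W.
have blocks : E0 * E1 * E2 * Z1 * Z2 * Z3 =
    savg (block pos blk0) * savg (block pos blk1) * savg (block pos blk2).
  have b0 := subxx (block pos blk0); have b1 := subxx (block pos blk1).
  exact: (shuffle_three_blocks (EC blk0 blk1 _ _ s0 s1 isT) (EC blk0 blk2 _ _ s0 s2 isT)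
    (EC blk1 blk2 _ _ s1 s2 isT) (EC blk1 blk0 _ _ s1 b0 isT) (EC blk2 blk0 _ _ s2 b0 isT)
    (EC blk2 blk1 _ _ s2 b1 isT) Z1E Z2E Z3E).
have off k' l (A : {set 'I_n}) x : A \subset block pos k' -> k' != l ->
    x \in block pos l -> x \notin A.
  move=> sA kl xl; apply/negP=> /(subsetP sA) xk.
  by have /pred0P/(_ x) := dis _ _ kl; rewrite /= xk xl.
have sEg : [/\ block pos blk0 :\: X \subset grid pos :\: X,
    block pos blk1 :\: Y \subset grid pos :\: X &
    block pos blk2 :\: W \subset grid pos :\: X].
  split; first by rewrite setSD ?block_grid.
    apply: subset_trans s1 _; apply/subsetP=> x xk.
    by rewrite inE (off blk0 blk1) ?(subsetP (block_grid _ _) _ xk).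
  apply: subset_trans s2 _; apply/subsetP=> x xk.
  by rewrite inE (off blk0 blk2) ?(subsetP (block_grid _ _) _ xk).
have dE : [/\ [disjoint block pos blk0 :\: X & slots],
    [disjoint block pos blk1 :\: Y & slots] & [disjoint block pos blk2 :\: W & slots]].
  have far k' (A : {set 'I_n}) :
      (forall j, (j < 7)%N -> slot_block j == k' -> slot pos j \in A) ->
      [disjoint block pos k' :\: A & slots].
    move=> inA; apply/pred0P=> x /=; apply/negP=> /andP[xE /imsetP[j _ xj]].
    move: xE; rewrite xj inE (mem_pos pos_inj) => /andP[/negP nA jk].
    by apply: nA; apply: inA => //; apply: ltn_ord.
  have slots0 j : (j < 4)%N -> slot pos j \in X.
    move=> j4; have j7 : (j < 7)%N by apply: leq_trans j4 _.
    apply/imsetP; exists (Ordinal j7) => //; rewrite inE /=.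
    by case: j j4 {j7} => [|[|[|[|j]]]].
  by split; apply: far => -[|[|[|[|[|[|[|j]]]]]]] // _ _; rewrite ?slots0 // !inE eqxx ?orbT.
case: sEg => sE0 sE1 sE2; case: dE => dE0 dE1 dE2.
have sXs : X \subset slots by apply: imsetS; apply: subsetT.
have through (B : {set 'I_n}) : [disjoint B & slots] ->
    savg B * (savg X * mix_word G pos (mixer a b s)) =
    savg X * mix_word G pos (mixer a b s) * savg B.
  move=> dB; rewrite mulrA (savgC G (disjointWr sXs dB)) -mulrA mix_word_comm //.
  by rewrite mulrA.
have split_start : savg (grid pos :\: X) = savg (grid pos :\: X) * (E0 * E1 * E2).
  by rewrite !mulrA !savg_absr.
set U := savg X * _ in through *; pose E := E0 * E1 * E2.
have EU : E * U = U * E.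
  rewrite /E -(mulrA (E0 * E1)) (through _ dE2) (mulrA (E0 * E1)).
  by rewrite -(mulrA E0) (through _ dE1) (mulrA E0) (through _ dE0) !mulrA.
rewrite split_start -/E.
have -> : savg (grid pos :\: X) * E * (U * Z1 * Z2 * Z3 *
      (triple_shuffle G pos (enum 'I_m.+4) * gelt G p)) =
    savg (grid pos :\: X) * (E * U) * Z1 * Z2 * Z3 *
      triple_shuffle G pos (enum 'I_m.+4) * gelt G p by rewrite !mulrA.
have -> : savg (grid pos :\: X) * (E * U) * Z1 * Z2 * Z3 =
    savg (grid pos :\: X) * U * (E * Z1 * Z2 * Z3) by rewrite EU !mulrA.
rewrite blocks; congr (_ * _); rewrite -mix start_mixE block_shuffleE /U.
by rewrite !mulrA.
Qed.

End Core.

(** * Recursion over the number of positions *)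

Section Recursion.
Variables (R : realType) (n : nat) (G : group_algebra R {perm 'I_n}) (c : 'I_n).
Hypothesis c0 : c = 0%N :> nat.

Lemma grid_exists m : (3 * m < n)%N -> exists pos : 'I_m -> 'I_3 -> 'I_n,
  (forall i k j l, pos i k = pos j l -> i = j /\ k = l) /\ c \notin grid pos.
Proof.
move=> mn; pose pos (i : 'I_m) (k : 'I_3) : 'I_n := insubd c (3 * i + k).+1.
have posE i k : pos i k = (3 * i + k).+1 :> nat.
  have i_lt := ltn_ord i; have k_lt := ltn_ord k.
  by rewrite val_insubd; case: ifP => // /negbT; rewrite -leqNgt; lia.
exists pos; split=> [i k j l /(congr1 val) /=|].
  rewrite !posE => -[ijkl]; have k_lt := ltn_ord k; have l_lt := ltn_ord l.
  by split; apply: val_inj => /=; lia.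
by apply/negP=> /gridP[i [k /(congr1 val) /=]]; rewrite posE c0.
Qed.

(** The grid avoids the centre, which is then added to it; the permutation p
    of [grid_shuffle] moves only points of the extended set. *)
Lemma shuffle_cost4_triple m k : (3 * m.+4 < n)%N -> shuffle_cost G 4 m.+4 k ->
  shuffle_cost G 4 (3 * m.+4).+1 (k + 7 * m.+4 + 49).
Proof.
move=> mn cost; have [pos [pos_inj cgrid]] := grid_exists mn.
have [p pS [Z Zw ZE]] := grid_shuffle pos_inj c0 cgrid cost.
have [Z' Z'w Z'E] := extend_by c0 cgrid (occupied_grid pos start) Zw ZE.
have card4 := card_start pos_inj.
rewrite savgMr // card4 in Z'w Z'E.
have sXc : occupied pos start \subset c |: grid pos.
  by apply: subset_trans (occupied_grid pos start) (subsetUr _ _).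
have sh : shuffles G (3 * 4 + (k + 7 * m.+4 + 35)) (occupied pos start) (c |: grid pos).
  by exists Z'.
have := shuffle_cost_of_one c0 sXc sh.
rewrite card4 cardsU1 cgrid (card_grid pos_inj) add1n.
by apply: shuffle_cost_le; clear; lia.
Qed.

Lemma shuffle_cost4_step m q k : (4 <= m)%N -> (3 * m < q <= 3 * m + 3)%N -> (q <= n)%N ->
  shuffle_cost G 4 m k -> shuffle_cost G 4 q (k + 7 * m + 73).
Proof.
case: m => [|[|[|[|m]]]] // _ qm qn cost.
have mn : (3 * m.+4 < n)%N by clear -qm qn; lia.
have cost1 := shuffle_cost4_triple mn cost.
have m4 : (4 <= (3 * m.+4).+1)%N by clear; lia.
have cost2 := shuffle_cost_extend c0 m4 cost1.
have cost3 := shuffle_cost_extend c0 (leqW m4) cost2.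
have : (q == (3 * m.+4).+1) || (q == (3 * m.+4).+2) || (q == (3 * m.+4).+3).
  by clear -qm; lia.
case/orP=> [/orP[]|] /eqP->.
- by apply: shuffle_cost_le cost1; clear; lia.
- by apply: shuffle_cost_le cost2; clear; lia.
- by apply: shuffle_cost_le cost3; clear; lia.
Qed.

(** The recursion divides the number of positions by three.  The constant 146
    is twice the overhead of a step, and it also covers the sizes below 13,
    where the counters are inserted one by one. *)
Lemma shuffle_cost4 q : (q <= n)%N -> exists2 k, shuffle_cost G 4 q k &
  (2 * k <= 7 * q + 146 * (trunc_log 3 q).+1)%N.
Proof.
elim/ltn_ind: q => q IH qn; have [q13 | q13] := ltnP q 13.
  exists (4 * q.+1)%N; first exact: (shuffle_cost_insert G c0).
  by clear -q13; lia.
pose m := (q.-1 %/ 3)%N.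
have m4 : (4 <= m)%N by rewrite /m; clear -q13; lia.
have qm : (3 * m < q <= 3 * m + 3)%N by rewrite /m; clear -q13; lia.
have mq : (m < q)%N by clear -qm; lia.
have [k cost kb] := IH m mq (leq_trans (ltnW mq) qn).
exists (k + 7 * m + 73)%N; first exact: shuffle_cost4_step.
have : ((trunc_log 3 m).+1 <= trunc_log 3 q)%N.
  rewrite -trunc_logMp //; last by apply: leq_trans m4.
  by apply: leq_trunc_log; case/andP: qm => /ltnW.
by move: (trunc_log 3 m) (trunc_log 3 q) kb => u v; clear -qm; lia.
Qed.

Lemma shuffle_cost_blocks l r q : (4 * l + r <= q)%N -> (q <= n)%N ->
  exists2 k, shuffle_cost G (4 * l + r) q k &
  (2 * k <= 2 * r * q.+1 + l * (7 * q + 146 * (trunc_log 3 q).+1))%N.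
Proof.
elim: l q => [|l IH] q lq qn.
  exists (r * q.+1)%N; first by rewrite muln0 add0n; apply: (shuffle_cost_insert G c0).
  by rewrite mulnA addn0.
have q4 : (4 <= q)%N by clear -lq; lia.
have [|| k cost kb] := IH (q - 4)%N; [clear -lq; lia | clear -qn; lia |].
have [k4 cost4 k4b] := shuffle_cost4 qn.
exists (k + k4)%N.
  have -> : (4 * l.+1 + r = 4 * l + r + 4)%N by clear; lia.
  rewrite -{1}(subnK q4) in cost4; have := shuffle_costD cost cost4.
  by rewrite subnK.
have tl : (trunc_log 3 (q - 4) <= trunc_log 3 q)%N by apply: leq_trunc_log; lia.
rewrite mulnDr; apply: leq_trans (leq_add kb k4b) _.
have le1 : (2 * r * (q - 4).+1 <= 2 * r * q.+1)%N.
  by rewrite leq_mul2l; apply/orP; right; clear; lia.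
have le2 : (l * (7 * (q - 4) + 146 * (trunc_log 3 (q - 4)).+1) <=
            l * (7 * q + 146 * (trunc_log 3 q).+1))%N.
  by rewrite leq_mul2l; apply/orP; right; clear -tl; lia.
by rewrite (mulSn l) [in leqRHS](addnC (7 * q + _)%N) [leqRHS]addnA leq_add2r; apply: leq_add.
Qed.

Lemma shuffle_cost_all l r : (4 * l + r <= n)%N ->
  exists2 k, shuffle_cost G (4 * l + r) (4 * l + r) k &
  (2 * k <= 2 * r * r.+1 + 14 * l * l.+1 + 7 * r * l + l * (146 * (trunc_log 3 n).+1))%N.
Proof.
elim: l => [|l IH] ln.
  exists (r * r.+1)%N; first by rewrite muln0 add0n; apply: (shuffle_cost_insert G c0).
  by clear; lia.
have [|k cost kb] := IH; first by clear -ln; lia.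
have [k4 cost4 k4b] := shuffle_cost4 ln.
exists (k + k4)%N.
  have e : (4 * l.+1 + r = 4 * l + r + 4)%N by clear; lia.
  by rewrite e in cost4 *; apply: shuffle_costD.
have tl : (trunc_log 3 (4 * l.+1 + r) <= trunc_log 3 n)%N by apply: leq_trunc_log.
move: (trunc_log 3 _) (trunc_log 3 n) tl kb k4b => u v; clear; nia.
Qed.
End Recursion.

Lemma min_star_length_le (R : realType) (t n k : nat) :
  (0 < n)%N -> (t <= n)%N ->
  shuffle_cost (regular_algebra R {perm 'I_n}) t n k ->
  exists2 m, is_min_star_length R t n m & (m <= k)%N.
Proof.
move=> n0 tn /(star_shuffle_of_cost tn)[m hm mk].
pose P k := `[< has_star_shuffle R t n k >].
have exP : exists k, P k by exists m; apply/asboolP.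
have [i /asboolP Pi min_i] := ex_minnP exP.
exists i; last by apply: leq_trans mk; apply: min_i; apply/asboolP.
by split=> // j hj; apply: min_i; apply/asboolP.
Qed.

Lemma trunc_log3_ln (R : realType) (n : nat) : (3 <= n)%N ->
  (trunc_log 3 n).+1%:R <= 2 / ln 3 * ln n%:R :> R.
Proof.
move=> n3; have ln3 : 0 < ln 3 :> R by rewrite ln_gt0 // ltr1n.
have n0 : (0 < n)%N by apply: leq_trans n3.
have n1 : 1 <= ln n%:R / ln 3 :> R.
  by rewrite ler_pdivlMr // mul1r ler_ln ?posrE ?ltr0n // ler_nat.
have tl : (trunc_log 3 n)%:R <= ln n%:R / ln 3 :> R.
  rewrite ler_pdivlMr // mulr_natl -lnXn ?ltr0n // ler_ln ?posrE ?exprn_gt0 ?ltr0n //.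
  by rewrite -natrX ler_nat trunc_logP.
by rewrite -natr1 mulrAC -mulrA mulr_natl mulr2n lerD.
Qed.

Local Open Scope classical_set_scope.

Theorem theorem6 (R : realType) :
  (forall l : nat, exists C : R, \forall n \near \oo,
     forall r : nat, (r <= 3)%N ->
     exists2 m : nat, is_min_star_length R (4 * l + r)%N n m &
       m%:R <= (7 * l%:R / 2 + r%:R) * n%:R + C * ln n%:R) /\
  (exists C : R, \forall n \near \oo,
     exists2 m : nat, is_min_star_length R n n m &
       m%:R <= 7 / 8 * 'C(n, 2)%:R + C * (n%:R * ln n%:R)).
Proof.
split=> [l|].
  exists ((3 + l%:R * 73) * (2 / ln 3)); near=> n => r r3.
  have n_large : (4 * l + 3 <= n)%N by near: n; apply: nbhs_infty_ge.
  have n3 : (3 <= n)%N by apply: leq_trans n_large; apply: leq_addl.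
  have tn : (4 * l + r <= n)%N by apply: leq_trans n_large; rewrite leq_add2l.
  have n0 : (0 < n)%N by apply: leq_trans n3.
  have [k cost kb] := shuffle_cost_blocks (regular_algebra R {perm 'I_n})
    (c := Ordinal n0) erefl tn (leqnn n).
  have [m minm mk] := min_star_length_le n0 tn cost.
  exists m => //.
  have {mk kb} : (2 * m <= 2 * r * n.+1 + l * (7 * n + 146 * (trunc_log 3 n).+1))%N.
    by apply: leq_trans kb; rewrite leq_mul2l mk.
  rewrite -(ler_nat R) !(natrD, natrM) -(natr1 n).
  have := trunc_log3_ln R n3.
  set u := (trunc_log 3 n).+1%:R; set v := 2 / ln 3 * ln n%:R => uv.
  have r3R : r%:R <= 3 :> R by rewrite ler_nat.
  have u1 : 1 <= u by rewrite ler1n.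
  have lu : l%:R * u <= l%:R * v by apply: ler_wpM2l; rewrite ?ler0n.
  rewrite -[_ * _ * ln _]mulrA -/v; clearbody u v.
  (* As 1 <= u <= v, the term r <= 3 is at most 3 v. *)
  by move=> mb; nra.
exists (172 * (2 / ln 3)); near=> n.
have n3 : (3 <= n)%N by near: n; apply: nbhs_infty_ge.
have n0 : (0 < n)%N by apply: leq_trans n3.
pose l := (n %/ 4)%N; pose r := (n %% 4)%N.
have nE : n = (4 * l + r)%N by rewrite mulnC -divn_eq.
have r4 : (r < 4)%N by apply: ltn_mod.
have tn : (4 * l + r <= n)%N by rewrite -nE.
have [k cost kb] := shuffle_cost_all (regular_algebra R {perm 'I_n})
  (c := Ordinal n0) erefl tn.
rewrite -nE in cost.
have [m minm mk] := min_star_length_le n0 (leqnn n) cost.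
exists m => //.
have {mk kb} : (2 * m <= 2 * r * r.+1 + 14 * l * l.+1 + 7 * r * l
    + l * (146 * (trunc_log 3 n).+1))%N by apply: leq_trans kb; rewrite leq_mul2l mk.
rewrite -(ler_nat R) !(natrD, natrM) -(natr1 l) -(natr1 r).
have := trunc_log3_ln R n3.
set u := (trunc_log 3 n).+1%:R; set v := 2 / ln 3 * ln n%:R => uv.
have r3R : r%:R <= 3 :> R by rewrite ler_nat.
have u1 : 1 <= u by rewrite ler1n.
have nER : n%:R = 4 * l%:R + r%:R :> R by rewrite {1}nE natrD natrM.
have bin2 : 'C(n, 2)%:R = n%:R * (n%:R - 1) / 2 :> R.
  by rewrite !binSR ?bin0 ?subr0; [field | lia | lia].
have lu : l%:R * u <= l%:R * v by apply: ler_wpM2l; rewrite ?ler0n.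
have lv : l%:R <= l%:R * v by rewrite ler_peMr //; lra.
have rv : r%:R <= r%:R * v by rewrite ler_peMr //; lra.
have rr : r%:R * r%:R <= 3 * r%:R :> R by rewrite ler_wpM2r.
have -> : 172 * (2 / ln 3) * (n%:R * ln n%:R) = 172 * (n%:R * v) :> R by rewrite /v; ring.
have r0 : 0 <= r%:R :> R by []. have l0 : 0 <= l%:R :> R by [].
have rr0 : 0 <= r%:R * r%:R :> R by rewrite mulr_ge0.
have lr0 : 0 <= l%:R * r%:R :> R by rewrite mulr_ge0.
by rewrite bin2 nER => mb; clearbody u v; nra.
Unshelve. all: by end_near.
Qed.
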